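(* Let $A$ and $B$ be graded commutative unitary algebras over $\mathbb{K}$ with differentials $d_A$, $d_B$ (degree one, squaring to zero, $d_A(\mathbf{1}_A)=0$, $d_B(\mathbf{1}_B)=0$, not necessarily algebra derivations), and let $(\sigma,\tau,h)$ be a semifull algebra contraction of $(A,d_A)$ onto $(B,d_B)$. Then the $L_\infty[1]$ algebra structure on $A$ with Taylor coefficients the Koszul brackets $\mathcal{K}(d_A)_n$, $n\ge1$, transfers along $(\sigma,\tau,h)$ to the $L_\infty[1]$ algebra structure on $B$ with Taylor coefficients the Koszul brackets $\mathcal{K}(d_B)_n$, $n\ge1$. Moreover, the induced $L_\infty[1]$ morphism $(S(B),\mathcal{K}(d_B))\to(S(A),\mathcal{K}(d_A))$ is precisely $\kappa(\tau)$, i.e., its Taylor coefficients are the cumulants $\kappa(\tau)_n$ of $\tau$.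
   Context: $\mathbb{K}$ is a field of characteristic zero; all spaces are $\mathbb{Z}$-graded, $V[m]^i=V^{i+m}$, and $\pm_K$ denotes the appropriate Koszul sign. $S(i_1,\ldots,i_k)$ is the set of $(i_1,\ldots,i_k)$-unshuffles. $S(V)=\bigoplus_{n\ge0}V^{\odot n}$ is the symmetric coalgebra; coalgebra morphisms $S(V)\to S(W)$ and coderivations of $S(V)$ are determined by their Taylor coefficients, i.e. the components $V^{\odot n}\to W$ (resp. $V^{\odot n}\to V$) of their corestrictions. An $L_\infty[1]$ algebra structure on $V$ is a degree one coderivation $Q$ of $S(V)$ with $Q(\mathbf{1}_{S(V)})=0$ and $Q^2=0$; an $L_\infty[1]$ morphism is a morphism of DG coalgebras $F:(S(V),Q)\to(S(W),R)$. Contraction. A contraction $(\sigma,\tau,h)$ of a DG space $(A,d_A)$ onto $(B,d_B)$ consists of DG maps $\sigma:A\to B$, $\tau:B\to A$ and a map $h:A\to A[-1]$ (degree $-1$) with $\sigma\tau=\mathrm{id}_B$, $hd_A+d_Ah=\tau\sigma-\mathrm{id}_A$, $\sigma h=0$, $h\tau=0$, $h^2=0$. Semifull algebra contraction. With $A,B,d_A,d_B$ as in the claim, a contraction $(\sigma,\tau,h)$ is a semifull algebra contraction if for all $a,b\in A$, $x,y\in B$: $h(h(a)h(b))=h(h(a)\tau(x))=h(\tau(x)\tau(y))=h(\mathbf{1}_A)=0$, $\sigma(h(a)h(b))=\sigma(h(a)\tau(x))=0$, $\sigma(\tau(x)\tau(y))=xy$, $\sigma(\mathbf{1}_A)=\mathbf{1}_B$.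 Homotopy transfer. Given an $L_\infty[1]$ algebra $(V,q_1,q_2,\ldots)$ and a contraction $(g_1,f_1,h)$ of $(V,q_1)$ onto $(W,r_1)$, the transferred $L_\infty[1]$ structure $R=(r_1,r_2,\ldots)$ on $W$ and the induced $L_\infty[1]$ morphism $F=(f_1,f_2,\ldots):W\to V$ are determined recursively, for $n\ge2$, by \[ f_n(x_1,\ldots,x_n)=\sum_{k\ge2,\ i_1,\ldots,i_k\ge1,\ i_1+\cdots+i_k=n}\ \sum_{\pi\in S(i_1,\ldots,i_k)}\pm_K\frac{1}{k!}\,h\,q_k\big(f_{i_1}(x_{\pi(1)},\ldots),\ldots,f_{i_k}(\ldots,x_{\pi(n)})\big), \] and $r_n$ is given by the same expression with $h$ replaced by $g_1$. Cumulants and Koszul brackets. For a graded commutative unitary algebra $A$, $E:S(A)\to S(A)$ is the coalgebra automorphism with Taylor coefficients $e_n(a_1,\ldots,a_n)=a_1\cdots a_n$ ($n\ge1$), and $L=E^{-1}$. For a degree zero $f:A\to B$ with $f(\mathbf{1}_A)=\mathbf{1}_B$, $\kappa(f):=L\circ S(f)\circ E$, with $S(f)(a_1\odot\cdots\odot a_n)=f(a_1)\odot\cdots\odot f(a_n)$; its Taylor coefficients are the cumulants $\kappa(f)_n:A^{\odot n}\to B$. For $\Delta\in\operatorname{End}(A)$ with $\Delta(\mathbf{1}_A)=0$, $\mathcal{K}(\Delta):=L\circ\widetilde\Delta\circ E$, where $\widetilde\Delta$ is the coderivation with only nonzero Taylor coefficient $\widetilde\Delta_1=\Delta$; its Taylor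 coefficients are the Koszul brackets $\mathcal{K}(\Delta)_n:A^{\odot n}\to A$. *)

(* Defs.v *)
From HB Require Import structures.
From mathcomp Require Import all_boot all_order all_algebra perm.
From mathcomp Require Import boolp freeg.

Set Implicit Arguments.
Unset Strict Implicit.
Unset Printing Implicit Defensive.

Import GRing.Theory.
Local Open Scope ring_scope.

Section LinearQuotient.
Variables (K : fieldType) (V : lmodType K) (R : V -> Prop).

Definition in_span (x : V) : Prop :=
  exists2 s : seq (K * V),
    forall p, p \in s -> R p.2 & x = \sum_(p <- s) p.1 *: p.2.

Definition span : {pred V} := fun x => `[< in_span x >].

Lemma spanP x : reflect (in_span x) (x \in span).
Proof. exact: asboolP. Qed.

Lemma span0 : 0 \in span.
Proof. by apply/spanP; exists [::]; rewrite ?big_nil. Qed.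

Lemma spanZD a x y : x \in span -> y \in span -> a *: x + y \in span.
Proof.
move=> /spanP[s Rs ->] /spanP[t Rt ->]; apply/spanP.
exists ([seq (a * p.1, p.2) | p <- s] ++ t).
  move=> p; rewrite mem_cat => /orP[/mapP[q qs ->]|/Rt //].
  exact: (Rs q qs).
rewrite big_cat big_map /= scaler_sumr; congr (_ + _).
by apply: eq_bigr => p _; rewrite scalerA.
Qed.

Lemma spanZ a x : x \in span -> a *: x \in span.
Proof. by move=> xS; rewrite -[_ *: _]addr0 spanZD // span0. Qed.

Lemma spanB : zmod_closed span.
Proof.
split=> [|x y xS yS]; first exact: span0.
by rewrite addrC -scaleN1r spanZD.
Qed.

HB.instance Definition _ := GRing.isZmodClosed.Build V span spanB.

Lemma mem_span x : R x -> x \in span.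
Proof.
move=> Rx; apply/spanP; exists [:: (1, x)]; last by rewrite big_seq1 scale1r.
by move=> p; rewrite inE => /eqP->.
Qed.

(* The quotient of V by the subspace spanned by R. *)
Definition lquot := Quotient.quot span.
HB.instance Definition _ := GRing.Zmodule.on lquot.

Definition lquot_pi (x : V) : lquot := \pi_(lquot)%qT x.

Lemma lquot_piP x y : reflect (lquot_pi x = lquot_pi y) (x - y \in span).
Proof. by rewrite (Quotient.idealrBE span x y); exact: eqP. Qed.

Lemma lquot_repr (q : lquot) : lquot_pi (repr q) = q.
Proof. exact: reprK. Qed.

Lemma lquot_piB : {morph lquot_pi : x y / x - y}.
Proof. by move=> x y; rewrite /lquot_pi !piE. Qed.

Lemma lquot_piD : {morph lquot_pi : x y / x + y}.
Proof. by move=> x y; rewrite /lquot_pi !piE. Qed.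

Definition lquot_scale (a : K) (q : lquot) : lquot := lquot_pi (a *: repr q).

Lemma lquot_scale_pi a x : lquot_scale a (lquot_pi x) = lquot_pi (a *: x).
Proof.
apply/lquot_piP; rewrite -scalerBr; apply: spanZ.
by apply/lquot_piP; rewrite lquot_repr.
Qed.

Lemma lquot_scaleA a b q :
  lquot_scale a (lquot_scale b q) = lquot_scale (a * b) q.
Proof. by rewrite -[q]lquot_repr !lquot_scale_pi scalerA. Qed.

Lemma lquot_scale1 : left_id 1 lquot_scale.
Proof. by move=> q; rewrite -[q]lquot_repr lquot_scale_pi scale1r. Qed.

Lemma lquot_scaleDr : right_distributive lquot_scale +%R.
Proof.
move=> a p q; rewrite -[p]lquot_repr -[q]lquot_repr -lquot_piD.
by rewrite !lquot_scale_pi scalerDr lquot_piD.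
Qed.

Lemma lquot_scaleDl q : {morph lquot_scale^~ q : a b / a + b}.
Proof.
by move=> a b; rewrite -[q]lquot_repr !lquot_scale_pi scalerDl lquot_piD.
Qed.

HB.instance Definition _ := GRing.Zmodule_isLmodule.Build K lquot
  lquot_scaleA lquot_scale1 lquot_scaleDr lquot_scaleDl.

Lemma lquot_pi_linear : linear lquot_pi.
Proof. by move=> a x y; rewrite lquot_piD -lquot_scale_pi. Qed.

HB.instance Definition _ :=
  GRing.isLinear.Build K V lquot _ lquot_pi lquot_pi_linear.

Lemma lquot_rel x : R x -> lquot_pi x = 0.
Proof.
move=> Rx; have <- : lquot_pi 0 = 0 by exact: raddf0.
by apply/lquot_piP; rewrite subr0 mem_span.
Qed.

Section Lift.
Variables (M : lmodType K) (f : {linear V -> M}).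
Hypothesis f_rel : forall x, R x -> f x = 0.

Let lift_fun (q : lquot) : M := f (repr q).

Let lift_fun_pi x : lift_fun (lquot_pi x) = f x.
Proof.
suff H y : y \in span -> f y = 0.
  apply/eqP; rewrite -subr_eq0 /lift_fun -raddfB; apply/eqP/H.
  by apply/lquot_piP; rewrite lquot_repr.
move=> /spanP[s Rs ->]; rewrite raddf_sum big_seq big1 //= => p ps.
by rewrite linearZ_LR f_rel ?scaler0 //; exact: Rs.
Qed.

Let lift_fun_linear : linear lift_fun.
Proof.
move=> a p q; rewrite -[p]lquot_repr -[q]lquot_repr -linearP.
by rewrite !lift_fun_pi linearP.
Qed.

Let lift_linear : {linear lquot -> M} :=
  HB.pack lift_fun (GRing.isLinear.Build K lquot M _ lift_fun lift_fun_linear).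

Definition lquot_lift : {linear lquot -> M} := locked lift_linear.

Lemma lquot_lift_pi x : lquot_lift (lquot_pi x) = f x.
Proof. rewrite /lquot_lift -lock; exact: lift_fun_pi. Qed.

End Lift.
End LinearQuotient.
(* The K-module with generators T and relations R. *)
Section Presentation.
Variables (K : fieldType) (T : choiceType).

Definition fgen (t : T) : {freeg T / K} := Freeg [:: (1, t)].

Lemma freeg_gen_ind (P : {freeg T / K} -> Prop) :
  P 0 -> (forall a t x, P x -> P (a *: fgen t + x)) -> forall x, P x.
Proof.
move=> P0 PD x; rewrite -[x]freeg_sumE; elim: (dom x) => [|t s IH].
  by rewrite big_nil.
rewrite big_cons; set c := coeff t x.
have -> : Freeg [:: (c, t)] = c *: fgen t; last exact: PD.
by apply/eqP/freeg_eqP => u; rewrite coeffZ !coeffU mul1r.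
Qed.

Section FreeLift.
Variables (M : lmodType K) (f : T -> M).

Definition free_lift (x : {freeg T / K}) : M := fglift f x.

Lemma free_lift_gen t : free_lift (fgen t) = f t.
Proof. by rewrite /free_lift liftU scale1r. Qed.

Lemma free_lift_linear : linear free_lift.
Proof.
have liftB : {morph free_lift : x y / x - y} by exact: lift_is_additive.
have lift0 : free_lift 0 = 0 by rewrite -(subrr 0) liftB subrr.
have liftN x : free_lift (- x) = - free_lift x.
  by rewrite -[- x]sub0r liftB lift0 sub0r.
have liftD : {morph free_lift : x y / x + y}.
  by move=> x y; rewrite -[y in LHS]opprK liftB liftN opprK.
have lift_sum (I : Type) (s : seq I) (F : I -> {freeg T / K}) :
  free_lift (\sum_(i <- s) F i) = \sum_(i <- s) free_lift (F i).
  by apply: (big_morph _ liftD lift0).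
move=> a x y; rewrite liftD; congr (_ + _).
rewrite -[in RHS](freeg_sumE x) lift_sum /= scaler_sumr.
rewrite [a *: x]/(fgscale a x) /fgscale lift_sum; apply: eq_bigr => t _.
by rewrite /free_lift !liftU scalerA.
Qed.

HB.instance Definition _ :=
  GRing.isLinear.Build K {freeg T / K} M _ free_lift free_lift_linear.

Lemma free_lift_rel2 a t u :
  free_lift (fgen t - a *: fgen u) = f t - a *: f u.
Proof.
have -> : fgen t - a *: fgen u = (- a) *: fgen u + fgen t.
  by rewrite scaleNr addrC.
by rewrite free_lift_linear !free_lift_gen scaleNr addrC.
Qed.

Lemma free_lift_rel3 a t u v :
  free_lift (fgen t - (a *: fgen u + fgen v)) = f t - (a *: f u + f v).
Proof.
have -> : fgen t - (a *: fgen u + fgen v)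
    = (-1) *: (a *: fgen u + fgen v) + fgen t by rewrite scaleN1r addrC.
rewrite free_lift_linear free_lift_linear !free_lift_gen scaleN1r.
by rewrite addrC.
Qed.

End FreeLift.

Variable R : {freeg T / K} -> Prop.

Definition presented : lmodType K := lquot R.

Definition pgen (t : T) : presented := lquot_pi R (fgen t).

Lemma pres_ind (P : presented -> Prop) :
  P 0 -> (forall a t x, P x -> P (a *: pgen t + x)) -> forall x, P x.
Proof.
move=> P0 PD x; rewrite -[x]lquot_repr.
elim/freeg_gen_ind: (repr x) => [|a t y Py]; first by rewrite raddf0.
by rewrite linearP; exact: PD.
Qed.

Lemma pres_eq (M : lmodType K) (f g : {linear presented -> M}) :
  (forall t, f (pgen t) = g (pgen t)) -> f =1 g.
Proof.
move=> fg; elim/pres_ind => [|a t x IH]; first by rewrite !raddf0.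
by rewrite !linearP fg IH.
Qed.

Definition pres_lift (M : lmodType K) (f : T -> M)
    (f_rel : forall r, R r -> free_lift f r = 0) : {linear presented -> M} :=
  @lquot_lift K _ R M (free_lift f) f_rel.

Lemma pres_lift_gen (M : lmodType K) (f : T -> M) f_rel t :
  @pres_lift M f f_rel (pgen t) = f t.
Proof. by rewrite lquot_lift_pi; exact: free_lift_gen. Qed.

End Presentation.

Section Tensor.
Variable K : fieldType.

Section Def.
Variables U W : lmodType K.

Inductive tensor_rel : {freeg (U * W)%type / K} -> Prop :=
| TensorL a x y w :
    tensor_rel (fgen K (a *: x + y, w) - (a *: fgen K (x, w) + fgen K (y, w)))
| TensorR a x v w :
    tensor_rel (fgen K (x, a *: v + w) - (a *: fgen K (x, v) + fgen K (x, w))).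

Definition tensor : lmodType K := presented tensor_rel.

Definition tens (x : U) (w : W) : tensor := pgen tensor_rel (x, w).

Lemma tensDl a x y w : tens (a *: x + y) w = a *: tens x w + tens y w.
Proof.
by apply/eqP; rewrite -subr_eq0 -linearP -raddfB; apply/eqP/lquot_rel/TensorL.
Qed.

Lemma tensDr a x v w : tens x (a *: v + w) = a *: tens x v + tens x w.
Proof.
by apply/eqP; rewrite -subr_eq0 -linearP -raddfB; apply/eqP/lquot_rel/TensorR.
Qed.

Lemma tens0r x : tens x 0 = 0.
Proof.
have -> : 0 = (-1) *: 0 + 0 :> W by rewrite scaler0 addr0.
by rewrite tensDr scaleN1r addNr.
Qed.

Lemma tens0l w : tens 0 w = 0.
Proof.
have -> : 0 = (-1) *: 0 + 0 :> U by rewrite scaler0 addr0.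
by rewrite tensDl scaleN1r addNr.
Qed.

Lemma tensZl a x w : tens (a *: x) w = a *: tens x w.
Proof. by rewrite -[a *: x]addr0 tensDl tens0l addr0. Qed.

Lemma tensZr a x w : tens x (a *: w) = a *: tens x w.
Proof. by rewrite -[a *: w]addr0 tensDr tens0r addr0. Qed.

Lemma tensor_eq (M : lmodType K) (f g : {linear tensor -> M}) :
  (forall x w, f (tens x w) = g (tens x w)) -> f =1 g.
Proof. by move=> fg; apply: pres_eq => -[x w]; exact: fg. Qed.

End Def.

Section Map.
Variables (U U' W W' : lmodType K).
Variables (f : {linear U -> U'}) (g : {linear W -> W'}).

Lemma tmap_rel r : tensor_rel r ->
  free_lift (fun p : U * W => tens (f p.1) (g p.2)) r = 0.
Proof.
by case=> *; rewrite free_lift_rel3 /= linearP (tensDl, tensDr) subrr.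
Qed.

(* f (x) g without sign; Koszul signs are added where it is used. *)
Definition tmap : {linear tensor U W -> tensor U' W'} := pres_lift tmap_rel.

Lemma tmapE x w : tmap (tens x w) = tens (f x) (g w).
Proof. exact: pres_lift_gen. Qed.

End Map.
End Tensor.

(* Z-graded spaces as internal direct sums, given by the projections onto the
   homogeneous components. *)
Structure gradedSpace (K : fieldType) := GradedSpace {
  gspace :> lmodType K;
  gproj : int -> {linear gspace -> gspace};
  gproj_id : forall i x, gproj i (gproj i x) = gproj i x;
  gproj_orth : forall i j x, i != j -> gproj i (gproj j x) = 0;
  gproj_sum : forall x, exists s : seq int, x = \sum_(i <- s) gproj i x
}.

Section Graded.
Variable K : fieldType.
Implicit Types V W : gradedSpace K.

Definition homog V (i : int) (x : V) : Prop := gproj V i x = x.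

(* Homogeneous linear maps of degree m. *)
Structure gmap (m : int) V W := GMap {
  gmap_fun :> {linear V -> W};
  gmap_deg : forall i x, homog i x -> homog (i + m) (gmap_fun x)
}.

Variable V : gradedSpace K.

Definition gsupp (x : V) : seq int := undup (sval (cid (gproj_sum x))).

Definition godd (x : V) : V := \sum_(i <- gsupp x | odd `|i|%N) gproj V i x.

Lemma gproj_supp i x : i \notin gsupp x -> gproj V i x = 0.
Proof.
rewrite mem_undup => /negP iS; rewrite (svalP (cid (gproj_sum x))).
rewrite raddf_sum big_seq big1 // => j js /=; apply: gproj_orth.
by apply: contraPneq iS => ->.
Qed.

Lemma goddE s x : uniq s -> {subset gsupp x <= s} ->
  godd x = \sum_(i <- s | odd `|i|%N) gproj V i x.
Proof.
move=> s_uniq sub.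
rewrite (bigID (mem (gsupp x))) /= addrC big1 ?add0r; last first.
  by move=> i /andP[_ /gproj_supp].
rewrite /godd -[LHS]big_filter -[RHS]big_filter; apply: perm_big.
apply: uniq_perm; rewrite ?filter_uniq ?undup_uniq // => i.
rewrite !mem_filter; case: (boolP (i \in gsupp x)) => [ix|].
  by rewrite (sub _ ix) !andbT.
by rewrite !andbF.
Qed.

Lemma godd_linear : linear godd.
Proof.
move=> a x y; pose s := undup (gsupp (a *: x + y) ++ gsupp x ++ gsupp y).
have subs z : {subset gsupp z <= gsupp (a *: x + y) ++ gsupp x ++ gsupp y} ->
  {subset gsupp z <= s} by move=> H i /H; rewrite mem_undup.
rewrite !(@goddE s) ?undup_uniq //.
- rewrite scaler_sumr -big_split; apply: eq_bigr => i _.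
  by rewrite linearP.
- by apply: subs => i iz; rewrite !mem_cat iz !orbT.
- by apply: subs => i iz; rewrite !mem_cat iz !orbT.
- by apply: subs => i iz; rewrite mem_cat iz.
Qed.

HB.instance Definition _ := GRing.isLinear.Build K V V _ godd godd_linear.

Lemma gproj_homog i j x : homog i x -> gproj V j x = if j == i then x else 0.
Proof.
move=> xi; case: eqVneq => [->//|ji]; by rewrite -xi gproj_orth.
Qed.

Lemma godd_homog i x : homog i x -> godd x = if odd `|i|%N then x else 0.
Proof.
move=> xi; have [s [s_uniq s_i s_x]] :
  exists s, [/\ uniq s, i \in s & {subset gsupp x <= s}].
  exists (undup (i :: gsupp x)); split=> [||j jx].
  - exact: undup_uniq.
  - by rewrite mem_undup mem_head.
  - by rewrite mem_undup inE jx orbT.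
rewrite (goddE s_uniq s_x) big_mkcond (bigD1_seq i) //= xi.
rewrite big1 ?addr0 // => j /negPf ji.
by rewrite (gproj_homog _ xi) ji if_same.
Qed.

Lemma homogZ i a (x : V) : homog i x -> homog i (a *: x).
Proof. by move=> xi; rewrite /homog linearZ_LR xi. Qed.

(* The parity involution, multiplication by (-1)^i in degree i. *)
Definition gsgn (x : V) : V := x - godd x *+ 2.

Lemma gsgn_linear : linear gsgn.
Proof.
move=> a x y; rewrite /gsgn linearP mulrnDl scalerBr scalerMnr opprD.
by rewrite addrACA.
Qed.

HB.instance Definition _ := GRing.isLinear.Build K V V _ gsgn gsgn_linear.

Lemma expN1z (i : int) : (-1 : K) ^ i = (-1) ^+ odd `|i|%N.
Proof.
case: i => n; first by rewrite -exprnP absz_nat signr_odd.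
by rewrite NegzE abszN absz_nat -exprnN -exprVn invrN1 signr_odd.
Qed.

Lemma gsgn_homog i (x : V) : homog i x -> gsgn x = (-1) ^ i *: x.
Proof.
move=> xi; rewrite /gsgn (godd_homog xi) expN1z; case: odd.
  by rewrite expr1 scaleN1r mulr2n opprD addrA subrr add0r.
by rewrite mul0rn subr0 expr0 scale1r.
Qed.

Lemma gsgn_deg i (x : V) : homog i x -> homog (i + 0) (gsgn x).
Proof. by move=> xi; rewrite addr0 (gsgn_homog xi); exact: homogZ. Qed.

Definition gparity : gmap 0 V V := GMap gsgn_deg.

End Graded.

Section SymmetricCoalgebra.
Variable K : fieldType.
Implicit Types V W : gradedSpace K.

Inductive sym_rel V : {freeg (seq V) / K} -> Prop :=
| SymLinear u a x y w : sym_rel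
    (fgen K (u ++ (a *: x + y) :: w)
     - (a *: fgen K (u ++ x :: w) + fgen K (u ++ y :: w)))
| SymSwap u i j x y w : homog i x -> homog j y -> sym_rel
    (fgen K (u ++ [:: x, y & w])
     - (-1) ^ (i * j) *: fgen K (u ++ [:: y, x & w])).

(* S(V), with word [:: x1; ...; xn] for the product x1 (.) ... (.) xn. *)
Definition symc V : lmodType K := presented (@sym_rel V).

Definition word V (w : seq V) : symc V := pgen (@sym_rel V) w.

Section Words.
Variable V : gradedSpace K.
Implicit Types (u w : seq V) (x y : V).

Lemma wordP u a x y w :
  word (u ++ (a *: x + y) :: w) = a *: word (u ++ x :: w) + word (u ++ y :: w).
Proof.
apply/eqP; rewrite -subr_eq0 -linearP -raddfB; apply/eqP.
exact/lquot_rel/SymLinear.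
Qed.

Lemma word_swap u i j x y w : homog i x -> homog j y ->
  word (u ++ [:: x, y & w]) = (-1) ^ (i * j) *: word (u ++ [:: y, x & w]).
Proof.
move=> xi yj; apply/eqP; rewrite -subr_eq0 -linearZ -raddfB; apply/eqP.
exact/lquot_rel/SymSwap.
Qed.

Lemma symc_ind (P : symc V -> Prop) :
  P 0 -> (forall a w t, P t -> P (a *: word w + t)) -> forall t, P t.
Proof. exact: pres_ind. Qed.

Lemma symc_eq (M : lmodType K) (f g : {linear symc V -> M}) :
  (forall w, f (word w) = g (word w)) -> f =1 g.
Proof. exact: pres_eq. Qed.

Section Lift.
Variables (M : lmodType K) (f : seq V -> M).
Hypothesis f_lin : forall u a x y w,
  f (u ++ (a *: x + y) :: w) = a *: f (u ++ x :: w) + f (u ++ y :: w).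
Hypothesis f_swap : forall u i j x y w, homog i x -> homog j y ->
  f (u ++ [:: x, y & w]) = (-1) ^ (i * j) *: f (u ++ [:: y, x & w]).

Lemma sym_lift_rel r : sym_rel r -> free_lift f r = 0.
Proof.
case=> [u a x y w|u i j x y w xi yj].
  by rewrite free_lift_rel3 f_lin subrr.
by rewrite free_lift_rel2 (f_swap _ _ xi yj) subrr.
Qed.

Definition sym_lift : {linear symc V -> M} := pres_lift sym_lift_rel.

Lemma sym_liftE w : sym_lift (word w) = f w.
Proof. exact: pres_lift_gen. Qed.

End Lift.

Definition sym1 : symc V := word [::].

(* Left multiplication by an element of V. *)
Section Cons.
Variable x : V.

Let cons_lin u a y z w : word (x :: u ++ (a *: y + z) :: w) =
  a *: word (x :: u ++ y :: w) + word (x :: u ++ z :: w).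
Proof. exact: (wordP (x :: u)). Qed.

Let cons_swap u i j y z w : homog i y -> homog j z ->
  word (x :: u ++ [:: y, z & w]) =
  (-1) ^ (i * j) *: word (x :: u ++ [:: z, y & w]).
Proof. exact: (word_swap (x :: u)). Qed.

Definition scons : {linear symc V -> symc V} :=
  sym_lift (f := fun w => word (x :: w)) cons_lin cons_swap.

Lemma sconsE w : scons (word w) = word (x :: w).
Proof. exact: sym_liftE. Qed.

End Cons.

(* The projection S(V) -> V. *)
Definition proj1w w : V := if w is [:: x] then x else 0.

Let proj_lin u a x y w : proj1w (u ++ (a *: x + y) :: w) =
  a *: proj1w (u ++ x :: w) + proj1w (u ++ y :: w).
Proof.
case: u w => [|z [|z' u]] [|t w] //=; rewrite ?scaler0 ?addr0 //.
Qed.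

Let proj_swap u i j x y w : homog i x -> homog j y ->
  proj1w (u ++ [:: x, y & w]) =
  (-1) ^ (i * j) *: proj1w (u ++ [:: y, x & w]).
Proof. by case: u w => [|z [|z' u]] [|t w] //=; rewrite ?scaler0. Qed.

Definition sproj : {linear symc V -> V} := sym_lift proj_lin proj_swap.

Let counit_lin u a x y w : (nilp (u ++ (a *: x + y) :: w))%:R =
  a *: (nilp (u ++ x :: w))%:R + (nilp (u ++ y :: w))%:R :> K^o.
Proof. by case: u => [|z u] /=; rewrite scaler0 addr0. Qed.

Let counit_swap u i j x y w : homog i x -> homog j y ->
  (nilp (u ++ [:: x, y & w]))%:R =
  (-1) ^ (i * j) *: (nilp (u ++ [:: y, x & w]))%:R :> K^o.
Proof. by case: u => [|z u] /=; rewrite scaler0. Qed.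

Definition counit : {linear symc V -> K^o} :=
  sym_lift (f := fun w => (nilp w)%:R) counit_lin counit_swap.

(* The degree i part of S(V). *)
Definition sym_homog (i : int) (u : symc V) : Prop :=
  in_span (fun t => exists w : seq (int * V),
    [/\ forall p, p \in w -> homog p.1 p.2, \sum_(p <- w) p.1 = i
      & t = word [seq p.2 | p <- w]]) u.

End Words.

(* S(f) *)
Section Map.
Variables (V W : gradedSpace K) (f : gmap 0 V W).

Let map_lin u a x y w : word (map f (u ++ (a *: x + y) :: w)) =
  a *: word (map f (u ++ x :: w)) + word (map f (u ++ y :: w)).
Proof. by rewrite !map_cat /= linearP wordP. Qed.

Let map_swap u i j x y w : homog i x -> homog j y ->
  word (map f (u ++ [:: x, y & w])) =
  (-1) ^ (i * j) *: word (map f (u ++ [:: y, x & w])).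
Proof.
move=> /(gmap_deg f) + /(gmap_deg f); rewrite !addr0 => xi yj.
by rewrite !map_cat /=; apply: word_swap.
Qed.

Definition symc_map : {linear symc V -> symc W} :=
  sym_lift (f := fun w => word (map f w)) map_lin map_swap.

Lemma symc_mapE w : symc_map (word w) = word (map f w).
Proof. exact: sym_liftE. Qed.

End Map.

(* Multiplication by (-1)^i in degree i. *)
Definition ssgn V : {linear symc V -> symc V} := symc_map (gparity V).

(* The coproduct is the algebra morphism S(V) -> S(V) (x) S(V) for which the
   elements of V are primitive: it is given on words by the recursion
   D(x (.) u) = (x (x) 1 + 1 (x) x) D(u), where
   (1 (x) x) (u (x) v) = (-1)^(|x||u|) u (x) (x (.) v). *)
Section Coproduct.
Variable V : gradedSpace K.

Definition primitive_mul (x : V) (t : tensor (symc V) (symc V)) :=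
  tmap (scons x) idfun t + tmap idfun (scons (x - godd x)) t
  + tmap (ssgn V) (scons (godd x)) t.

Definition comul_word (w : seq V) : tensor (symc V) (symc V) :=
  foldr primitive_mul (tens (sym1 V) (sym1 V)) w.

End Coproduct.
Section CoproductTheory.
Variable V : gradedSpace K.
Implicit Types (x y : V) (u v : symc V) (t : tensor (symc V) (symc V)).

Lemma tens_ind (P : tensor (symc V) (symc V) -> Prop) :
  P 0 -> (forall a u v t, P t -> P (a *: tens u v + t)) -> forall t, P t.
Proof. by move=> P0 PD; apply: pres_ind => // a [u v] t; apply: PD. Qed.

Lemma scons_linear a x y u :
  scons (a *: x + y) u = a *: scons x u + scons y u.
Proof.
elim/symc_ind: u => [|b w u IH]; first by rewrite !raddf0 addr0.
rewrite !linearP IH !sconsE (wordP [::]) !scalerDr !scalerA mulrC.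
by rewrite addrACA.
Qed.

Lemma scons_swap i j x y u : homog i x -> homog j y ->
  scons x (scons y u) = (-1) ^ (i * j) *: scons y (scons x u).
Proof.
move=> xi yj; elim/symc_ind: u => [|b w u IH]; first by rewrite !raddf0.
rewrite !linearP IH !sconsE (word_swap [::] _ xi yj) !scalerA.
by rewrite mulrC.
Qed.

Lemma scons0 u : scons 0 u = 0.
Proof.
have /eqP := scons_linear 1 0 0 u.
by rewrite scale1r addr0 scale1r -subr_eq0 opprD addrA subrr sub0r oppr_eq0
  => /eqP.
Qed.

Lemma sconsZ a x u : scons (a *: x) u = a *: scons x u.
Proof. by rewrite -[a *: x]addr0 scons_linear scons0 addr0. Qed.

Lemma ssgn_scons i x u : homog i x ->
  ssgn V (scons x u) = (-1) ^ i *: scons x (ssgn V u).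
Proof.
move=> xi; elim/symc_ind: u => [|b w u IH]; first by rewrite !raddf0.
rewrite !linearP IH !sconsE !symc_mapE /= (gsgn_homog xi).
by rewrite -sconsE sconsZ !sconsE.
Qed.

Definition ssgn_pow (b : bool) : {linear symc V -> symc V} :=
  if b then ssgn V else idfun.

Lemma ssgn_pow_scons b i x u : homog i x ->
  ssgn_pow b (scons x u) = (-1) ^+ (b && odd `|i|%N) *: scons x (ssgn_pow b u).
Proof.
move=> xi; case: b => /=; last by rewrite expr0 scale1r.
by rewrite (ssgn_scons _ xi) expN1z.
Qed.

Lemma ssgnK u : ssgn V (ssgn V u) = u.
Proof.
suff gsgnK x : gsgn (gsgn x) = x.
  elim/symc_ind: u => [|b w u IH]; first by rewrite !raddf0.
  rewrite !linearP IH !symc_mapE /= -map_comp; congr (_ *: word _ + _).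
  by rewrite -[RHS]map_id; apply: eq_map => x /=; rewrite gsgnK.
have [s ->] := gproj_sum x; rewrite !raddf_sum; apply: eq_bigr => i _ /=.
have xi : homog i (gproj V i x) by exact: gproj_id.
rewrite (gsgn_homog xi) linearZ_LR /= (gsgn_homog xi) scalerA.
by rewrite expN1z -expr2 sqrr_sign scale1r.
Qed.

Lemma ssgn_powC b c u : ssgn_pow b (ssgn_pow c u) = ssgn_pow c (ssgn_pow b u).
Proof. by case: b; case: c. Qed.

Lemma primitive_mulE i x t : homog i x -> primitive_mul x t =
  tmap (scons x) idfun t + tmap (ssgn_pow (odd `|i|%N)) (scons x) t.
Proof.
move=> xi; rewrite /primitive_mul (godd_homog xi) -addrA; congr (_ + _).
have tmap0 (f : {linear symc V -> symc V}) : tmap f (scons 0) t = 0.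
  elim/tens_ind: t => [|b u v t IH]; first by rewrite raddf0.
  rewrite linearP IH addr0 tmapE scons0.
  by rewrite tens0r scaler0.
by case: odd => /=; rewrite ?subrr ?subr0 tmap0 ?add0r ?addr0.
Qed.

Lemma primitive_mul_linear x : linear (primitive_mul x).
Proof.
move=> a t t'; rewrite /primitive_mul !linearP !scalerDr.
by rewrite [X in X + _ = _]addrACA [LHS]addrACA.
Qed.

HB.instance Definition _ x := GRing.isLinear.Build K
  (tensor (symc V) (symc V)) (tensor (symc V) (symc V)) _
  (primitive_mul x) (primitive_mul_linear x).

Lemma primitive_mulDl a x y t :
  primitive_mul (a *: x + y) t = a *: primitive_mul x t + primitive_mul y t.
Proof.
elim/tens_ind: t => [|b u v t IH]; first by rewrite !raddf0 addr0.
rewrite !linearP /= IH [RHS]addrACA -scalerDr; congr (_ *: _ + _).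
rewrite /primitive_mul !tmapE /=.
have -> : a *: x + y - godd (a *: x + y)
    = a *: (x - godd x) + (y - godd y).
  by rewrite godd_linear scalerBr opprD addrACA.
rewrite godd_linear !scons_linear tensDl !tensDr !scalerDr.
by rewrite [X in X + _ = _]addrACA [LHS]addrACA.
Qed.

Lemma primitive_mul_swap i j x y t : homog i x -> homog j y ->
  primitive_mul x (primitive_mul y t) =
  (-1) ^ (i * j) *: primitive_mul y (primitive_mul x t).
Proof.
move=> xi yj; elim/tens_ind: t => [|b u v t IH]; first by rewrite !raddf0.
rewrite !linearP /= IH; congr (_ *: _ + _).
rewrite !(primitive_mulE _ xi) !(primitive_mulE _ yj).
rewrite !raddfD /= !tmapE /=.
rewrite (scons_swap _ xi yj) (scons_swap _ xi yj).
rewrite (ssgn_pow_scons _ _ xi) (ssgn_pow_scons _ _ yj) ssgn_powC.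
have -> : (-1 : K) ^ (i * j) = (-1) ^+ (odd `|i|%N && odd `|j|%N).
  by rewrite expN1z abszM oddM.
rewrite [odd `|j|%N && _]andbC; set e := (-1) ^+ _.
rewrite !tensZl !tensZr [e *: (e *: _)]scalerA -expr2 sqrr_sign scale1r.
by rewrite addrACA.
Qed.

Lemma comul_cat (u w : seq V) :
  comul_word (u ++ w) = foldr (@primitive_mul V) (comul_word w) u.
Proof. exact: foldr_cat. Qed.

Let comul_lin (u : seq V) a x y w : comul_word (u ++ (a *: x + y) :: w) =
  a *: comul_word (u ++ x :: w) + comul_word (u ++ y :: w).
Proof.
rewrite !comul_cat; elim: u => [|z u IH] /=; first exact: primitive_mulDl.
by rewrite IH linearP.
Qed.

Let comul_swap (u : seq V) i j x y w : homog i x -> homog j y ->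
  comul_word (u ++ [:: x, y & w]) =
  (-1) ^ (i * j) *: comul_word (u ++ [:: y, x & w]).
Proof.
move=> xi yj; rewrite !comul_cat.
elim: u => [|z u IH] /=; first exact: primitive_mul_swap.
by rewrite IH linearZ_LR.
Qed.

Definition comul : {linear symc V -> tensor (symc V) (symc V)} :=
  sym_lift comul_lin comul_swap.

Lemma comulE w : comul (word w) = comul_word w.
Proof. exact: sym_liftE. Qed.

End CoproductTheory.

(* The n-th Taylor coefficient of F at (x1, ..., xn). *)
Definition taylor V W (F : {linear symc V -> symc W}) (w : seq V) : W :=
  sproj W (F (word w)).

Definition coalgebra_morphism V W (F : {linear symc V -> symc W}) : Prop :=
  [/\ forall i u, sym_homog i u -> sym_homog i (F u),
      forall u, counit W (F u) = counit V u
    & forall u, comul W (F u) = tmap F F (comul V u)].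

(* Degree one coderivations, with (id (x) Q) (u (x) v) = (-1)^|u| u (x) Q v. *)
Definition coderivation V (Q : {linear symc V -> symc V}) : Prop :=
  (forall i u, sym_homog i u -> sym_homog (i + 1) (Q u)) /\
  (forall u, comul V (Q u) =
     tmap Q idfun (comul V u) + tmap (ssgn V) Q (comul V u)).

Definition linfty_structure V (Q : {linear symc V -> symc V}) : Prop :=
  [/\ coderivation Q, Q (sym1 V) = 0 & forall u, Q (Q u) = 0].

Definition linfty_morphism V W (Q : {linear symc V -> symc V})
    (R : {linear symc W -> symc W}) (F : {linear symc V -> symc W}) : Prop :=
  coalgebra_morphism F /\ forall u, F (Q u) = R (F u).

Definition contraction V W (dV : gmap 1 V V) (dW : gmap 1 W W)
    (sigma : gmap 0 V W) (tau : gmap 0 W V) (h : gmap (-1) V V) : Prop :=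
  [/\ forall a, sigma (dV a) = dW (sigma a),
      forall x, tau (dW x) = dV (tau x),
      forall x, sigma (tau x) = x,
      forall a, h (dV a) + dV (h a) = tau (sigma a) - a
    & [/\ forall a, sigma (h a) = 0, forall x, h (tau x) = 0
        & forall a, h (h a) = 0]].

(* The (i1, ..., ik)-unshuffles, for c = [:: i1; ...; ik]. *)
Definition unshuffle n (c : seq nat) (pi : 'S_n) : bool :=
  all (sorted ltn) (reshape c [seq val (pi i) | i <- enum 'I_n]).

(* x1 (.) ... (.) xn = koszul_sign d pi *: x_(pi 1) (.) ... (.) x_(pi n) when
   each xi is homogeneous of degree d i. *)
Definition koszul_sign n (d : 'I_n -> int) (pi : 'S_n) : K :=
  \prod_(i < n) \prod_(j < n | (i < j)%N && (pi j < pi i)%N)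
    (-1) ^ (d (pi i) * d (pi j)).

Definition transfer_sum V W (U : lmodType K) (g : V -> U) (q : seq V -> V) (f : seq W -> V)
    n (d : 'I_n -> int) (x : 'I_n -> W) : U :=
  \sum_(2 <= k < n.+1)
  \sum_(c : k.-tuple 'I_n.+1 |
          (0%N \notin map val c) && (sumn (map val c) == n))
  \sum_(pi : 'S_n | unshuffle (map val c) pi)
    (koszul_sign d pi / k`!%:R) *:
    g (q (map f (reshape (map val c) [seq x (pi i) | i <- enum 'I_n]))).

(* R is the structure transferred from Q along the contraction
   (sigma, tau, h), and F the induced morphism. As F and R are determined by
   their Taylor coefficients and these are multilinear, it is enough to give
   the recursion on homogeneous arguments, for which the sign makes sense. *)
Definition homotopy_transfer V W (dV : gmap 1 V V) (dW : gmap 1 W W)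
    (sigma : gmap 0 V W) (tau : gmap 0 W V) (h : gmap (-1) V V)
    (Q : {linear symc V -> symc V}) (R : {linear symc W -> symc W})
    (F : {linear symc W -> symc V}) : Prop :=
  [/\ contraction dV dW sigma tau h,
      [/\ linfty_structure Q, linfty_structure R & linfty_morphism R Q F],
      [/\ forall a, taylor Q [:: a] = dV a,
          forall x, taylor R [:: x] = dW x
        & forall x, taylor F [:: x] = tau x]
    & forall n (d : 'I_n -> int) (x : 'I_n -> W), (2 <= n)%N ->
        (forall i, homog (d i) (x i)) ->
        taylor F [seq x i | i <- enum 'I_n]
          = transfer_sum h (taylor Q) (taylor F) d x
        /\ taylor R [seq x i | i <- enum 'I_n]
          = transfer_sum sigma (taylor Q) (taylor F) d x].

End SymmetricCoalgebra.

(* Graded commutative unitary algebras; the zero algebra is allowed. *)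
Structure gcAlgebra (K : fieldType) := GCAlgebra {
  gcspace :> gradedSpace K;
  gmul : gcspace -> gcspace -> gcspace;
  gone : gcspace;
  gmulDl : forall a x y z, gmul (a *: x + y) z = a *: gmul x z + gmul y z;
  gmulDr : forall a x y z, gmul x (a *: y + z) = a *: gmul x y + gmul x z;
  gmulA : associative gmul;
  gmul1 : left_id gone gmul;
  gmul_deg : forall i j x y,
    homog i x -> homog j y -> homog (i + j) (gmul x y);
  gone_deg : homog 0 gone;
  gmulC : forall i j x y,
    homog i x -> homog j y -> gmul x y = (-1) ^ (i * j) *: gmul y x
}.

(* Definite description: used below only for maps that exist and are unique,
   so that the default value x0 is irrelevant. *)
Definition the (T : Type) (x0 : T) (P : T -> Prop) : T :=
  match pselect (exists x, P x) with
  | left exP => sval (cid exP)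
  | right _ => x0
  end.

Section Koszul.
Variable K : fieldType.
Implicit Types A B : gcAlgebra K.

Definition gprod A (w : seq A) : A := foldr (@gmul K A) (gone A) w.

(* The coalgebra automorphism with Taylor coefficients
   e_n(a1, ..., an) = a1 ... an for n >= 1 (and e_0 = 0). *)
Definition koszulE A : {linear symc A -> symc A} :=
  @the {linear symc A -> symc A} idfun (fun E =>
    coalgebra_morphism E /\
    forall w, taylor E w = if nilp w then 0 else gprod w).

Definition koszulL A : {linear symc A -> symc A} :=
  @the {linear symc A -> symc A} idfun (fun L =>
    cancel (koszulE A) L /\ cancel L (koszulE A)).

Definition cumulant A B (f : gmap 0 A B) : {linear symc A -> symc B} :=
  koszulL B \o symc_map f \o koszulE A.

(* The coderivation with linear Taylor coefficient Delta and no other. *)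
Definition linear_coderivation A (Delta : gmap 1 A A) :
    {linear symc A -> symc A} :=
  @the {linear symc A -> symc A} \0 (fun Q =>
    [/\ coderivation Q, forall a, taylor Q [:: a] = Delta a
      & forall w, size w != 1%N -> taylor Q w = 0]).

Definition koszul_brackets A (Delta : gmap 1 A A) :
    {linear symc A -> symc A} :=
  koszulL A \o linear_coderivation Delta \o koszulE A.

Definition semifull A B (sigma : gmap 0 A B) (tau : gmap 0 B A)
    (h : gmap (-1) A A) : Prop :=
  [/\ [/\ forall a b, h (gmul (h a) (h b)) = 0,
          forall a x, h (gmul (h a) (tau x)) = 0,
          forall x y, h (gmul (tau x) (tau y)) = 0
        & h (gone A) = 0],
      forall a b, sigma (gmul (h a) (h b)) = 0,
      forall a x, sigma (gmul (h a) (tau x)) = 0,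
      forall x y, sigma (gmul (tau x) (tau y)) = gmul x y
    & sigma (gone A) = gone B].

End Koszul.

(* Main.v *)
From HB Require Import structures.
Require Import Defs.
From mathcomp Require Import all_boot all_order all_algebra perm zify.
From mathcomp Require Import boolp.

Set Implicit Arguments.
Unset Strict Implicit.
Unset Printing Implicit Defensive.

Import GRing.Theory.
Local Open Scope ring_scope.

(** Write C for the kernel of h. The homotopy identity gives
    a = tau (sigma a) - h (dA a) for a in C, so that C = tau B + h A, and then
    the semifull conditions make C closed under products and sigma
    multiplicative on C (lemmas [ker_homotopy_mul] and [sigma_mul]).

    The values of S(tau) lie in the span of the words with letters in C, which L
    preserves, so the Taylor coefficients f_n of kappa(tau) = L S(tau) E have
    values in C. Conjugation
    by E turns a multiplicative map into its linear extension, whence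
    S(sigma) o kappa(tau) = S(sigma o tau) = id ([symc_map_cumulant]). In other
    words h f_n = 0 for all n, and sigma f_n = 0 for n >= 2.

    These two facts suffice. Indeed F = kappa(tau) intertwines the brackets
    R = K(dB) and Q = K(dA), because tau is a chain map and E L = id. A
    coalgebra morphism is the convolution exponential of its Taylor
    coefficients; hence the sum over k >= 2 and over unshuffles in the transfer
    formula is the value of Q on F w minus the linear part f_n(w) of F w
    ([transfer_sumE]). Its projection to A is pi (F (R w)) - dA f_n(w), where pi
    is the projection S(A) -> A. Applying h leaves - h (dA f_n(w)), which is
    f_n(w) by the homotopy identity; applying sigma leaves r_n(w).

    The rest is the coalgebra theory behind these statements. The morphism E
    adds the letters one at a time: a new letter x either stays alone or is
    multiplied into one of the existing letters, so E (x u) = x (E u) + D (E u)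
    where D is the coderivation that extends multiplication by x. E preserves
    the filtration by word length and is the identity on the associated graded
    space, hence it is bijective. As E and the coderivation of a linear map are
    given by definite description, uniqueness from the Taylor coefficients is
    proved as well, both for coalgebra morphisms and for coderivations. *)

(** * Induction principles for the symmetric coalgebra *)

Section Signs.
Variable K : fieldType.

Lemma signzD (i j : int) : (-1 : K) ^ (i + j) = (-1) ^ i * (-1) ^ j.
Proof. by rewrite expfzDr // oppr_eq0 oner_eq0. Qed.

Lemma signzMM (i : int) : (-1 : K) ^ i * (-1) ^ i = 1.
Proof. by rewrite expN1z -expr2 sqrr_sign. Qed.

End Signs.

Section Generation.
Variable K : fieldType.
Variable V : gradedSpace K.
Implicit Types (x y : V) (u v : symc V).

Lemma homog_ind (P : V -> Prop) :
  P 0 -> (forall i x y, homog i x -> P y -> P (x + y)) -> forall x, P x.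
Proof.
move=> P0 PD x; have [s ->] := gproj_sum x.
elim: s => [|i s IH]; first by rewrite big_nil.
rewrite big_cons; apply: (PD i) IH; exact: gproj_id.
Qed.

(** The span of the words whose letters are homogeneous and satisfy C. Its
    induction principle replaces inductions on words, and it restricts all sign
    computations to homogeneous letters. *)
Inductive letters_in (C : V -> Prop) : symc V -> Prop :=
| LettersLin a u v :
    letters_in C u -> letters_in C v -> letters_in C (a *: u + v)
| Letters1 : letters_in C (sym1 V)
| LettersCons i x u :
    homog i x -> C x -> letters_in C u -> letters_in C (scons x u).

Lemma letters_in0 C : letters_in C 0.
Proof.
have -> : 0 = (-1) *: sym1 V + sym1 V by rewrite scaleN1r addNr.
by apply: LettersLin; apply: Letters1.
Qed.

Lemma letters_inZ C a u : letters_in C u -> letters_in C (a *: u).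
Proof.
move=> Cu; rewrite -[a *: u]addr0; apply: LettersLin => //.
exact: letters_in0.
Qed.

Lemma letters_inD C u v :
  letters_in C u -> letters_in C v -> letters_in C (u + v).
Proof. by move=> Cu Cv; rewrite -[u]scale1r; apply: LettersLin. Qed.

Lemma letters_inB C u v :
  letters_in C u -> letters_in C v -> letters_in C (u - v).
Proof. by move=> Cu Cv; rewrite addrC -scaleN1r; apply: LettersLin. Qed.

Lemma sconsDl x y u : scons (x + y) u = scons x u + scons y u.
Proof. by rewrite -[x]scale1r scons_linear !scale1r. Qed.

Lemma letters_in_all u : letters_in (fun=> True) u.
Proof.
elim/symc_ind: u => [|a w u IH]; first exact: letters_in0.
apply: LettersLin IH; elim: w => [|x w IH]; first exact: Letters1.
rewrite -sconsE; elim/homog_ind: x => [|i x y xi IHy].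
  by rewrite scons0; apply: letters_in0.
by rewrite sconsDl; apply: letters_inD IHy; apply: (LettersCons xi _ IH).
Qed.

Lemma symc_hind (P : symc V -> Prop) :
    (forall a u v, P u -> P v -> P (a *: u + v)) -> P (sym1 V) ->
    (forall i x u, homog i x -> P u -> P (scons x u)) ->
  forall u, P u.
Proof.
move=> PL P1 PS u.
elim: (letters_in_all u) => [a v w _ + _| |i x v xi _ _] //; first exact: PL.
exact: PS xi.
Qed.

(** The sign (-1)^(m |x|) as a linear map in x: the sign for moving an operator
    of degree m past a letter that need not be homogeneous. *)
Definition gsgn_pow (m : int) : {linear V -> V} :=
  if odd `|m|%N then (@gsgn K V : {linear V -> V}) else idfun.

Lemma gsgn_powE m i x : homog i x -> gsgn_pow m x = (-1) ^ (m * i) *: x.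
Proof.
move=> xi; rewrite /gsgn_pow expN1z abszM oddM.
by case: odd => /=; rewrite ?expr0 ?scale1r // (gsgn_homog xi) expN1z.
Qed.

Lemma counit_scons x u : counit V (scons x u) = 0.
Proof.
elim/symc_ind: u => [|a w u IH]; first by rewrite !raddf0.
by rewrite !linearP IH sconsE sym_liftE /= scaler0 addr0.
Qed.

Lemma sproj_scons x u : sproj V (scons x u) = counit V u *: x.
Proof.
elim/symc_ind: u => [|a w u IH]; first by rewrite !raddf0 scale0r.
rewrite !linearP /= IH sconsE !sym_liftE scalerDl -scalerA; congr (_ *: _ + _).
by case: w => [|y w] /=; rewrite ?scale1r ?scale0r.
Qed.

Lemma counit1 : counit V (sym1 V) = 1.
Proof. by rewrite sym_liftE. Qed.

Lemma sproj1 : sproj V (sym1 V) = 0.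
Proof. by rewrite sym_liftE. Qed.

Lemma comul1 : comul V (sym1 V) = tens (sym1 V) (sym1 V).
Proof. by rewrite comulE. Qed.

Lemma comul_scons x u : comul V (scons x u) = primitive_mul x (comul V u).
Proof.
elim/symc_ind: u => [|a w u IH]; first by rewrite !raddf0.
by rewrite !linearP /= IH sconsE !comulE.
Qed.

End Generation.

Section Tmap.
Variable K : fieldType.

Lemma tensD_ind (U W : lmodType K) (P : tensor U W -> Prop) :
  P 0 -> (forall a u w t, P t -> P (a *: tens u w + t)) -> forall t, P t.
Proof. by move=> P0 PD; apply: pres_ind => // a [u w] t; apply: PD. Qed.

Lemma tensDL (U W : lmodType K) (x y : U) (w : W) :
  tens (x + y) w = tens x w + tens y w.
Proof. by rewrite -[x]scale1r tensDl !scale1r. Qed.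

Lemma tensDR (U W : lmodType K) (x : U) (v w : W) :
  tens x (v + w) = tens x v + tens x w.
Proof. by rewrite -[v]scale1r tensDr !scale1r. Qed.

Lemma tmap_comp (U U' U'' W W' W'' : lmodType K)
    (f : {linear U' -> U''}) (g : {linear W' -> W''})
    (f' : {linear U -> U'}) (g' : {linear W -> W'})
    (k : {linear U -> U''}) (l : {linear W -> W''}) :
    (forall u, f (f' u) = k u) -> (forall w, g (g' w) = l w) ->
  forall t, tmap f g (tmap f' g' t) = tmap k l t.
Proof.
move=> fk gl; elim/tensD_ind => [|a u w t IH]; first by rewrite !raddf0.
by rewrite !linearP /= IH !tmapE fk gl.
Qed.

Lemma tmap_comp3 (U0 U1 U2 U3 W0 W1 W2 W3 : lmodType K)
    (f : {linear U2 -> U3}) (g : {linear W2 -> W3})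
    (f' : {linear U1 -> U2}) (g' : {linear W1 -> W2})
    (f'' : {linear U0 -> U1}) (g'' : {linear W0 -> W1})
    (k : {linear U0 -> U3}) (l : {linear W0 -> W3}) :
    (forall u, f (f' (f'' u)) = k u) -> (forall w, g (g' (g'' w)) = l w) ->
  forall t, tmap f g (tmap f' g' (tmap f'' g'' t)) = tmap k l t.
Proof.
move=> fk gl t; rewrite (tmap_comp (k := f' \o f'') (l := g' \o g'')) //.
exact: tmap_comp.
Qed.

Lemma eq_tmap (U U' W W' : lmodType K)
    (f k : {linear U -> U'}) (g l : {linear W -> W'}) :
    f =1 k -> g =1 l -> tmap f g =1 tmap k l.
Proof.
move=> fk gl; elim/tensD_ind => [|a u w t IH]; first by rewrite !raddf0.
by rewrite !linearP /= IH !tmapE fk gl.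
Qed.

Lemma tmap_id (U W : lmodType K) (f : {linear U -> U}) (g : {linear W -> W}) :
  (forall u, f u = u) -> (forall w, g w = w) -> forall t, tmap f g t = t.
Proof.
move=> fk gl; elim/tensD_ind => [|a u w t IH]; first by rewrite !raddf0.
by rewrite !linearP /= IH !tmapE fk gl.
Qed.

End Tmap.

Section Degrees.
Variable K : fieldType.
Variable V : gradedSpace K.
Implicit Types (x y : V) (u v : symc V).

Lemma sym_homogP a i u v :
  sym_homog i u -> sym_homog i v -> sym_homog i (a *: u + v).
Proof. by move=> /spanP ui /spanP vi; apply/spanP/spanZD. Qed.

Lemma sym_homog0 i : sym_homog i (0 : symc V).
Proof. by apply/spanP/span0. Qed.

Lemma sym_homogZ a i u : sym_homog i u -> sym_homog i (a *: u).
Proof.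
by move=> ui; rewrite -[a *: u]addr0; apply: sym_homogP (sym_homog0 i).
Qed.

Lemma sym_homogD i u v : sym_homog i u -> sym_homog i v -> sym_homog i (u + v).
Proof. by move=> ui vi; rewrite -[u]scale1r; apply: sym_homogP. Qed.

Lemma sym_homogB i u v : sym_homog i u -> sym_homog i v -> sym_homog i (u - v).
Proof. by move=> ui vi; rewrite addrC -scaleN1r; apply: sym_homogP. Qed.

Lemma sym_homog_rec (P : int -> symc V -> Prop) :
    (forall i, P i 0) ->
    (forall i a u v, P i u -> P i v -> P i (a *: u + v)) -> P 0 (sym1 V) ->
    (forall i j x u, homog i x -> sym_homog j u -> P j u ->
       P (i + j) (scons x u)) ->
  forall i u, sym_homog i u -> P i u.
Proof.
move=> P0 PL P1 PS i _ [s sP ->]; elim: s sP => [|[a t] s IH] sP.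
  by rewrite big_nil.
rewrite big_cons; apply: PL; last first.
  by apply: IH => p ps; apply: sP; rewrite inE ps orbT.
have [w [wh <- /= ->]] := sP _ (mem_head _ _).
elim: w wh {sP} => [|[j x] w IHw] wh.
  by rewrite big_nil.
rewrite big_cons /= -sconsE; apply: PS.
- exact: (wh _ (mem_head _ _)).
- apply/spanP/mem_span; exists w; split=> // p pw; apply: wh.
  by rewrite inE pw orbT.
- by apply: IHw => p pw; apply: wh; rewrite inE pw orbT.
Qed.

Lemma sym_homog1 : sym_homog 0 (sym1 V).
Proof. by apply/spanP/mem_span; exists [::]; split; rewrite ?big_nil. Qed.

Lemma sym_homog_scons i j x u :
  homog i x -> sym_homog j u -> sym_homog (i + j) (scons x u).
Proof.
move=> xi [s sP ->]; rewrite raddf_sum big_seq.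
elim/big_ind: _ => [|v w vh wh|p ps]; first exact: sym_homog0.
  exact: sym_homogD.
rewrite /= linearZ_LR; apply: sym_homogZ.
have [w [wh <- ->]] := sP _ ps; rewrite sconsE; apply/spanP/mem_span.
exists ((i, x) :: w); split=> [q||]; rewrite ?big_cons //.
by rewrite inE => /predU1P[->|/wh].
Qed.

Lemma ssgn_homog i u : sym_homog i u -> ssgn V u = (-1) ^ i *: u.
Proof.
move: i u; apply: sym_homog_rec => [i|i a u v IHu IHv||i j x u xi _ IHu].
- by rewrite raddf0 scaler0.
- by rewrite linearP /= IHu IHv scalerDr !scalerA mulrC.
- by rewrite symc_mapE scale1r.
- by rewrite (ssgn_scons _ xi) IHu linearZ_LR scalerA signzD.
Qed.

Lemma sym_homog_ind (P : symc V -> Prop) :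
    (forall i u, sym_homog i u -> P u) ->
    (forall a u v, P u -> P v -> P (a *: u + v)) -> forall u, P u.
Proof.
move=> Ph PL u; suff [s [sh ->]]: exists s : seq (symc V),
    (forall v, v \in s -> exists i, sym_homog i v) /\ u = \sum_(v <- s) v.
  elim: s sh => [|v s IH] sh.
    by rewrite big_nil; apply: (Ph 0); apply: sym_homog0.
  rewrite big_cons -[v]scale1r; apply: PL; last first.
    by apply: IH => w ws; apply: sh; rewrite inE ws orbT.
  by have [i] := sh _ (mem_head _ _); apply: Ph.
elim/symc_hind: u => [a u v [s [sh ->]] [t [th ->]]||i x u xi [s [sh ->]]].
- exists ([seq a *: w | w <- s] ++ t).
  rewrite big_cat big_map scaler_sumr; split=> // w.
  rewrite mem_cat => /orP[/mapP[z /sh[i zi] ->]|/th //].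
  by exists i; apply: sym_homogZ.
- exists [:: sym1 V]; rewrite big_seq1; split=> // v; rewrite inE => /eqP->.
  by exists 0; apply: sym_homog1.
- exists [seq scons x w | w <- s]; rewrite big_map raddf_sum; split=> // w.
  by move=> /mapP[z /sh[j zj] ->]; exists (i + j); apply: sym_homog_scons.
Qed.

End Degrees.

(** Homogeneous elements span S(V), and on them both sides are explicit signs.
    It gives the commutation of E, L and coderivations with the parity
    involution from their degrees alone. *)
Lemma degree_ssgn (K : fieldType) (V W : gradedSpace K) (m : int)
    (F : {linear symc V -> symc W}) :
    (forall i u, sym_homog i u -> sym_homog (i + m) (F u)) ->
  forall u, ssgn W (F u) = (-1) ^ m *: F (ssgn V u).
Proof.
move=> Fm; elim/sym_homog_ind => [i u ui|a u v IHu IHv].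
  rewrite (ssgn_homog (Fm _ _ ui)) (ssgn_homog ui) linearZ_LR scalerA signzD.
  by rewrite mulrC.
by rewrite !linearP /= IHu IHv.
Qed.

(** * The coderivation extending a linear map *)

Section Coder.
Variables (K : fieldType) (V : gradedSpace K).

Section Def.
Variables (m : int) (f : gmap m V V).

(** The graded Leibniz rule. *)
Fixpoint coder_word (w : seq V) : symc V :=
  if w is y :: w' then
    word (f y :: w') + scons (gsgn_pow V m y) (coder_word w')
  else 0.

Lemma coder_word_lin u a x y w : coder_word (u ++ (a *: x + y) :: w) =
  a *: coder_word (u ++ x :: w) + coder_word (u ++ y :: w).
Proof.
elim: u => [|z u IH] /=.
  rewrite !linearP (wordP [::]) scons_linear scalerDr /=.
  by rewrite [LHS]addrACA.
by rewrite IH linearP (wordP (f z :: u)) scalerDr /= [LHS]addrACA.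
Qed.

Lemma coder_word_swap u i j x y w : homog i x -> homog j y ->
  coder_word (u ++ [:: x, y & w]) =
  (-1) ^ (i * j) *: coder_word (u ++ [:: y, x & w]).
Proof.
move=> xi yj; elim: u => [|z u IH] /=; last first.
  by rewrite IH linearZ_LR (word_swap (f z :: u) _ xi yj) scalerDr.
have fx := gmap_deg f xi; have fy := gmap_deg f yj.
rewrite !raddfD /= (gsgn_powE _ xi) (gsgn_powE _ yj) !sconsZ !sconsE.
rewrite (word_swap [::] _ fx yj) (word_swap [::] _ xi fy) /=.
rewrite (linearZ_LR (scons x)) (linearZ_LR (scons y)) /= (scons_swap _ xi yj).
rewrite !scalerA [RHS]addrCA.
rewrite mulrDl mulrDr !signzD; congr (_ *: _ + (_ *: _ + _ *: _)).
- by rewrite mulrCA [m * i]mulrC signzMM mulr1.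
- by rewrite mulrC [X in _ * X]mulrC.
Qed.

Definition coder : {linear symc V -> symc V} :=
  sym_lift coder_word_lin coder_word_swap.

Lemma coder1 : coder (sym1 V) = 0.
Proof. exact: sym_liftE. Qed.

Lemma coder_sconsE y u :
  coder (scons y u) = scons (f y) u + scons (gsgn_pow V m y) (coder u).
Proof.
elim/symc_ind: u => [|a w u IH]; first by rewrite !raddf0 addr0.
by rewrite !linearP /= IH !sconsE !sym_liftE /= scalerDr addrACA.
Qed.

Lemma coder_scons i y u : homog i y ->
  coder (scons y u) = scons (f y) u + (-1) ^ (m * i) *: scons y (coder u).
Proof. by move=> yi; rewrite coder_sconsE (gsgn_powE _ yi) sconsZ. Qed.

Lemma counit_coder u : counit V (coder u) = 0.
Proof.
elim/symc_hind: u => [a u v IHu IHv||i x u xi IHu].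
- by rewrite !linearP /= IHu IHv scaler0 addr0.
- by rewrite coder1 raddf0.
- rewrite (coder_scons _ xi) raddfD /= linearZ_LR /= !counit_scons.
  by rewrite scaler0 addr0.
Qed.

Lemma sproj_coder u : sproj V (coder u) = f (sproj V u).
Proof.
elim/symc_hind: u => [a u v IHu IHv||i x u xi IHu].
- by rewrite !linearP /= IHu IHv.
- by rewrite coder1 sproj1 !raddf0.
- rewrite (coder_scons _ xi) raddfD /= linearZ_LR /= !sproj_scons counit_coder.
  by rewrite scale0r scaler0 addr0 linearZ_LR.
Qed.

Lemma coder_homog i u : sym_homog i u -> sym_homog (i + m) (coder u).
Proof.
move: i u; apply: sym_homog_rec => [i|i a u v IHu IHv||i j x u xi uj IHu].
- by rewrite raddf0; apply: sym_homog0.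
- by rewrite linearP; apply: sym_homogP.
- by rewrite coder1; apply: sym_homog0.
rewrite (coder_scons _ xi); apply: sym_homogD.
  by rewrite addrAC; apply: sym_homog_scons => //; apply: gmap_deg.
by apply: sym_homogZ; rewrite -addrA; apply: sym_homog_scons.
Qed.

(** The sign (-1)^(m |u|) in the co-Leibniz rule for an operator of degree m. *)
Definition parity_sgn : {linear symc V -> symc V} := ssgn_pow V (odd `|m|%N).

Lemma parity_sgn_scons i x u : homog i x ->
  parity_sgn (scons x u) = (-1) ^ (m * i) *: scons x (parity_sgn u).
Proof.
by move=> xi; rewrite /parity_sgn (ssgn_pow_scons _ _ xi) expN1z abszM oddM.
Qed.

Lemma ssgn_coder u : ssgn V (coder u) = (-1) ^ m *: coder (ssgn V u).
Proof. exact: degree_ssgn coder_homog u. Qed.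

(** Co-Leibniz rule: by induction on the first letter x, both sides reduce to
    the same six terms, according to which tensor factor receives x and whether
    f hits x, the left factor or the right factor. *)
Lemma comul_coder u : comul V (coder u) =
  tmap coder idfun (comul V u) + tmap parity_sgn coder (comul V u).
Proof.
elim/symc_hind: u => [a u v IHu IHv||i x u xi].
- by rewrite !linearP /= IHu IHv scalerDr addrACA.
- by rewrite coder1 raddf0 comul1 !tmapE coder1 tens0l tens0r addr0.
rewrite (coder_scons _ xi) linearD linearZ_LR /= !comul_scons => ->.
have fx := gmap_deg f xi.
rewrite !(primitive_mulE _ xi) (primitive_mulE _ fx).
pose s := ssgn_pow V (odd `|i|%N).
(* Both sides are assembled as linear maps in t, so that it is enough to compare
   them on pure tensors. *)
pose T := {linear tensor (symc V) (symc V) -> tensor (symc V) (symc V)}.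
pose P (y : V) (r : {linear symc V -> symc V}) : T :=
  (tmap (scons y) idfun \+ tmap r (scons y))%R.
pose D : T := tmap coder idfun \+ tmap parity_sgn coder.
pose c : K := (-1) ^ (m * i).
pose L : T := P (f x) (ssgn_pow V (odd (absz (i + m)))) \+ (c \*: (P x s \o D)).
pose R : T := D \o P x s.
suff LR : L =1 R by exact: LR.
apply: tensor_eq => v w; rewrite /L /R /P /D /= !raddfD /= !tmapE /=.
have -> : ssgn_pow V (odd (absz (i + m))) v = s (parity_sgn v).
  rewrite /s /parity_sgn /ssgn_pow.
  have -> : odd (absz (i + m)) = odd `|i|%N (+) odd `|m|%N by lia.
  by case: (odd `|i|%N); case: (odd `|m|%N); rewrite //= ssgnK.
have coder_s z : s (coder z) = c *: coder (s z).
  rewrite /s /c /ssgn_pow expN1z abszM oddM.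
  case: (odd `|i|%N) => /=; first by rewrite ssgn_coder expN1z andbT.
  by rewrite andbF expr0 scale1r.
rewrite coder_s !(coder_scons _ xi) (parity_sgn_scons _ xi) -/c.
have -> : parity_sgn (s v) = s (parity_sgn v) by apply: ssgn_powC.
rewrite !tensDL !tensDR !tensZl !tensZr scalerA.
have -> : c * c = 1 by apply: signzMM.
by rewrite scale1r !addrA [LHS](ACl (1*3*5*4*2*6)).
Qed.

Lemma coder_letters (C : V -> Prop) u :
  (forall x, C x -> C (f x)) -> letters_in C u -> letters_in C (coder u).
Proof.
move=> Cf; elim=> [a v w _ IHv _ IHw||i x v xi Cx Cv IHv].
- by rewrite linearP; apply: LettersLin.
- by rewrite coder1; apply: letters_in0.
- rewrite (coder_scons _ xi); apply: letters_inD.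
    exact: LettersCons (gmap_deg f xi) (Cf _ Cx) Cv.
  by apply: letters_inZ; apply: LettersCons xi Cx IHv.
Qed.

End Def.

Lemma coder_lin m (f g k : gmap m V V) a : (forall x, f x = a *: g x + k x) ->
  forall u, coder f u = a *: coder g u + coder k u.
Proof.
move=> fgk; elim/symc_hind => [b u v IHu IHv||i x u xi IHu].
- rewrite !linearP /= IHu IHv !scalerDr !scalerA [b * a]mulrC.
  by rewrite [LHS]addrACA.
- by rewrite !coder1 scaler0 addr0.
- rewrite !coder_sconsE IHu fgk scons_linear linearP scalerDr /=.
  by rewrite [LHS]addrACA.
Qed.

(** The graded commutator of two coderivations of this kind extends the graded
    commutator of the linear maps. For m = n = 1 and f = g of square zero this
    shows that the coderivation has square zero. *)
Lemma coder_comm m n (f : gmap m V V) (g : gmap n V V) :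
    (forall x, f (g x) = (-1) ^ (m * n) *: g (f x)) ->
  forall u, coder f (coder g u) = (-1) ^ (m * n) *: coder g (coder f u).
Proof.
move=> fg; elim/symc_hind => [b u v IHu IHv||i x u xi IHu].
- rewrite !linearP /= IHu IHv; congr (_ + _).
- by rewrite !coder1 !raddf0.
rewrite !(coder_scons _ _ xi) !linearD /= (linearZ_LR (coder f)).
rewrite (linearZ_LR (coder g)) /=.
rewrite (coder_scons _ _ (gmap_deg g xi)) (coder_scons _ _ (gmap_deg f xi)).
rewrite !(coder_scons _ _ xi) fg IHu sconsZ (linearZ_LR (scons x)) /=.
rewrite !scalerDr !scalerA !addrA [RHS](ACl (1*3*2*4)).
rewrite !mulrDr !signzD.
congr (_ + _ *: _ + _ *: _ + _ *: _).
- exact: mulrC.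
- by rewrite mulrCA [n * m]mulrC signzMM mulr1.
- by rewrite mulrC [X in _ * X]mulrC mulrA.
Qed.

End Coder.

(** * Functoriality *)

Section SymMap.
Variables (K : fieldType) (V W : gradedSpace K) (phi : gmap 0 V W).

Lemma symc_map1 : symc_map phi (sym1 V) = sym1 W.
Proof. exact: symc_mapE. Qed.

Lemma symc_map_scons x u :
  symc_map phi (scons x u) = scons (phi x) (symc_map phi u).
Proof.
elim/symc_ind: u => [|a w u IH]; first by rewrite !raddf0.
by rewrite !linearP /= IH sconsE !symc_mapE sconsE.
Qed.

Lemma gmap0_homog i x : homog i x -> homog i (phi x).
Proof. by move=> /(gmap_deg phi); rewrite addr0. Qed.

Lemma sproj_symc_map u : sproj W (symc_map phi u) = phi (sproj V u).
Proof.
elim/symc_ind: u => [|a w u IH]; first by rewrite !raddf0.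
rewrite !linearP /= IH symc_mapE !sym_liftE.
by case: w => [|x [|y w]]; rewrite /= ?raddf0.
Qed.

Lemma symc_map_coder (C : V -> Prop) m (f : gmap m V V) (g : gmap m W W) :
    (forall x, C x -> phi (f x) = g (phi x)) ->
  forall u, letters_in C u ->
  symc_map phi (coder f u) = coder g (symc_map phi u).
Proof.
move=> Cfg u; elim=> [a v w _ IHv _ IHw||i x v xi Cx _ IHv].
- by rewrite !linearP /= IHv IHw.
- by rewrite coder1 raddf0 symc_map1 coder1.
rewrite symc_map_scons (coder_scons _ _ xi) (coder_scons _ _ (gmap0_homog xi)).
by rewrite linearD linearZ_LR /= !symc_map_scons Cfg // IHv.
Qed.

Lemma symc_map_coalgebra : coalgebra_morphism (symc_map phi).
Proof.
split=> [|u|u].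
- apply: sym_homog_rec => [i|i a u v IHu IHv||i j x u xi uj IHu].
  + by rewrite raddf0; apply: sym_homog0.
  + by rewrite linearP; apply: sym_homogP.
  + by rewrite symc_map1; apply: sym_homog1.
  + by rewrite symc_map_scons; apply: sym_homog_scons => //; apply: gmap0_homog.
- elim/symc_hind: u => [a u v IHu IHv||i x u xi IHu].
  + by rewrite !linearP /= IHu IHv.
  + by rewrite symc_map1 !counit1.
  + by rewrite symc_map_scons !counit_scons.
have sgn_map v b :
    ssgn_pow W b (symc_map phi v) = symc_map phi (ssgn_pow V b v).
  case: b => //=; elim/symc_hind: v => [a v w IHv IHw||i x v xi IHv].
  + by rewrite !linearP /= IHv IHw.
  + by rewrite !symc_mapE.
  + rewrite symc_map_scons (ssgn_scons _ xi) (ssgn_scons _ (gmap0_homog xi)).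
    by rewrite IHv linearZ_LR /= symc_map_scons.
elim/symc_hind: u => [a u v IHu IHv||i x u xi IHu].
- by rewrite !linearP /= IHu IHv.
- by rewrite symc_map1 !comul1 tmapE symc_map1.
rewrite symc_map_scons !comul_scons IHu (primitive_mulE _ xi).
rewrite (primitive_mulE _ (gmap0_homog xi)) raddfD /=; congr (_ + _).
  by rewrite !(tmap_comp (k := symc_map phi \o scons x) (l := symc_map phi)) //
    => v; rewrite /= symc_map_scons.
rewrite !(tmap_comp (k := symc_map phi \o ssgn_pow V (odd `|i|))
  (l := symc_map phi \o scons x)) // => v;
  by rewrite /= ?symc_map_scons ?sgn_map.
Qed.

End SymMap.

(** * The grading by word length *)

Section Length.
Variables (K : fieldType) (V : gradedSpace K).

Let len_word k (w : seq V) := if size w == k then word w else 0.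

Let len_word_lin k u a x y w : len_word k (u ++ (a *: x + y) :: w) =
  a *: len_word k (u ++ x :: w) + len_word k (u ++ y :: w).
Proof.
rewrite /len_word !size_cat /= wordP.
by case: eqP => // _; rewrite scaler0 addr0.
Qed.

Let len_word_swap k u i j x y w : homog i x -> homog j y ->
  len_word k (u ++ [:: x, y & w]) =
  (-1) ^ (i * j) *: len_word k (u ++ [:: y, x & w]).
Proof.
move=> xi yj; rewrite /len_word !size_cat /= (word_swap _ _ xi yj).
by case: eqP => // _; rewrite scaler0.
Qed.

Definition slen k : {linear symc V -> symc V} :=
  sym_lift (@len_word_lin k) (@len_word_swap k).

Lemma slen_word k w : slen k (word w) = if size w == k then word w else 0.
Proof. exact: sym_liftE. Qed.

Lemma slen_scons k x u : slen k.+1 (scons x u) = scons x (slen k u).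
Proof.
elim/symc_ind: u => [|a w u IH]; first by rewrite !raddf0.
rewrite !linearP /= IH sconsE !slen_word /= eqSS.
by case: eqP; rewrite ?sconsE ?raddf0.
Qed.

Lemma slen0_scons x u : slen 0 (scons x u) = 0.
Proof.
elim/symc_ind: u => [|a w u IH]; first by rewrite !raddf0.
by rewrite !linearP /= IH sconsE slen_word scaler0 addr0.
Qed.

Lemma slen0 u : slen 0 u = counit V u *: sym1 V.
Proof.
elim/symc_hind: u => [a u v IHu IHv||i x u xi IHu].
- by rewrite !linearP /= IHu IHv scalerDl scalerA.
- by rewrite slen_word counit1 scale1r.
- by rewrite slen0_scons counit_scons scale0r.
Qed.

Lemma slen1 u : slen 1 u = word [:: sproj V u].
Proof.
have wordD a x y :
    word [:: a *: x + y] = a *: word [:: x] + word [:: y] :> symc V.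
  exact: (wordP [::]).
have word0 : word [:: 0 : V] = 0.
  have -> : 0 = (-1) *: 0 + 0 :> V by rewrite scaler0 addr0.
  by rewrite wordD scaleN1r addNr.
elim/symc_hind: u => [a u v IHu IHv||i x u xi IHu].
- by rewrite !linearP /= IHu IHv wordD.
- by rewrite slen_word sproj1 word0.
- rewrite slen_scons slen0 linearZ_LR /= sconsE sproj_scons.
  have -> : counit V u *: x = counit V u *: x + 0 by rewrite addr0.
  by rewrite wordD word0 addr0.
Qed.

Lemma slen_coder m (f : gmap m V V) k u :
  slen k (coder f u) = coder f (slen k u).
Proof.
elim/symc_hind: u k => [a u v IHu IHv k|k|i x u xi IHu [|k]].
- by rewrite !linearP /= IHu IHv.
- by rewrite coder1 !slen_word; case: eqP => _; rewrite ?raddf0 // coder1.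
- rewrite slen0_scons (coder_scons _ _ xi) !raddf0 linearD linearZ_LR /=.
  by rewrite !slen0_scons scaler0 addr0.
- rewrite slen_scons !(coder_scons _ _ xi) linearD linearZ_LR /=.
  by rewrite !slen_scons IHu.
Qed.

(** The two halves are equivalent; both are kept because the first gives
    inductions on M and the second is what one computes with. *)
Definition len_below M (u : symc V) :=
  u = \sum_(k < M) slen k u /\ forall k, (M <= k)%N -> slen k u = 0.

Lemma slenK k j u : slen k (slen j u) = if k == j then slen k u else 0.
Proof.
elim/symc_ind: u => [|a w u IH]; first by rewrite !raddf0 if_same.
rewrite !linearP /= IH !slen_word; case: (size w =P j) => [<-|wj].
  by rewrite slen_word eq_sym; case: eqP; rewrite ?scaler0 ?addr0.
rewrite raddf0; case: eqP => [->|];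
  by rewrite ?(negPf (introN eqP wj)) ?scaler0 ?addr0.
Qed.

Lemma len_belowP M u : u = \sum_(k < M) slen k u -> len_below M u.
Proof.
move=> uE; split=> // k Mk; rewrite uE raddf_sum big1 // => j _ /=.
by rewrite slenK gtn_eqF // (leq_trans (ltn_ord j)).
Qed.

Lemma len_below_leq M N u : (M <= N)%N -> len_below M u -> len_below N u.
Proof.
move=> MN [uE u0]; split=> [|k Nk]; last by apply: u0; apply: leq_trans Nk.
rewrite {1}uE -!(big_mkord xpredT (fun k => slen k u)).
rewrite [RHS](big_cat_nat (n := M)) //=.
rewrite [X in _ + X]big1_seq ?addr0 // => k /andP[_].
by rewrite mem_index_iota => /andP[/u0].
Qed.

Lemma len_below_word (w : seq V) : len_below (size w).+1 (word w).
Proof.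
apply: len_belowP.
rewrite big_ord_recr big1 /= ?add0r ?slen_word ?eqxx // => k _.
by rewrite slen_word gtn_eqF.
Qed.

Lemma len_belowD M a u v : len_below M u -> len_below M v ->
  len_below M (a *: u + v).
Proof.
move=> [uE u0] [vE v0]; apply: len_belowP; rewrite {1}uE {1}vE.
by rewrite scaler_sumr -big_split /=; apply: eq_bigr => k _; rewrite linearP.
Qed.

Lemma len_below_ex u : exists M, len_below M u.
Proof.
elim/symc_ind: u => [|a w u [M uM]].
  by exists 0; apply: len_belowP; rewrite big_ord0.
exists (maxn (size w).+1 M); apply: len_belowD.
- exact: len_below_leq (leq_maxl _ _) (len_below_word _).
- exact: len_below_leq (leq_maxr _ _) uM.
Qed.

End Length.

(** * Coderivations are determined by their Taylor coefficients *)

Section TensLift.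
Variables (K : fieldType) (U W M : lmodType K) (b : U -> W -> M).
Hypothesis bl : forall a x y w, b (a *: x + y) w = a *: b x w + b y w.
Hypothesis br : forall a x v w, b x (a *: v + w) = a *: b x v + b x w.

Lemma tens_lift_rel r : tensor_rel r ->
  free_lift (fun p : U * W => b p.1 p.2) r = 0.
Proof. by case=> *; rewrite free_lift_rel3 /= (bl, br) subrr. Qed.

Definition tens_lift : {linear tensor U W -> M} := pres_lift tens_lift_rel.

Lemma tens_liftE x w : tens_lift (tens x w) = b x w.
Proof. exact: pres_lift_gen. Qed.

End TensLift.

Section Counit.
Variables (K : fieldType) (V : gradedSpace K) (M : lmodType K).
Variable f : {linear symc V -> M}.

Lemma counitl_linl a (x y w : symc V) :
  counit V (a *: x + y) *: f w = a *: (counit V x *: f w) + counit V y *: f w.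
Proof. by rewrite linearP scalerDl scalerA. Qed.

Lemma counitl_linr a (x v w : symc V) :
  counit V x *: f (a *: v + w) = a *: (counit V x *: f v) + counit V x *: f w.
Proof. by rewrite linearP scalerDr !scalerA mulrC. Qed.

Definition counitl : {linear tensor (symc V) (symc V) -> M} :=
  tens_lift counitl_linl counitl_linr.

Lemma counitlE x w : counitl (tens x w) = counit V x *: f w.
Proof. exact: tens_liftE. Qed.

Lemma counitr_linl a (x y w : symc V) :
  counit V w *: f (a *: x + y) = a *: (counit V w *: f x) + counit V w *: f y.
Proof. by rewrite linearP scalerDr !scalerA mulrC. Qed.

Lemma counitr_linr a (x v w : symc V) :
  counit V (a *: v + w) *: f x = a *: (counit V v *: f x) + counit V w *: f x.
Proof. by rewrite linearP scalerDl scalerA. Qed.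

Definition counitr : {linear tensor (symc V) (symc V) -> M} :=
  tens_lift counitr_linl counitr_linr.

Lemma counitrE x w : counitr (tens x w) = counit V w *: f x.
Proof. exact: tens_liftE. Qed.

End Counit.

Section FirstLetter.
Variables (K : fieldType) (V : gradedSpace K).

Lemma counit_ssgn u : counit V (ssgn V u) = counit V u.
Proof.
elim/symc_hind: u => [a u v IHu IHv||i x u xi IHu].
- by rewrite !linearP /= IHu IHv.
- by rewrite symc_mapE.
- by rewrite (ssgn_scons _ xi) linearZ_LR /= !counit_scons scaler0.
Qed.

Lemma counit_ssgn_pow b u : counit V (ssgn_pow V b u) = counit V u.
Proof. by case: b => //=; apply: counit_ssgn. Qed.

Lemma counitl_comul (M : lmodType K) (f : {linear symc V -> M}) u :
  counitl f (comul V u) = f u.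
Proof.
elim/symc_hind: u M f => [a u v IHu IHv M f|M f|i x u xi IHu M f].
- by rewrite !linearP /= IHu IHv.
- by rewrite comul1 counitlE counit1 scale1r.
rewrite comul_scons (primitive_mulE _ xi) linearD /=.
rewrite -[RHS](IHu M (f \o scons x)).
elim/tens_ind: (comul V u) => [|c v w t IH]; first by rewrite !raddf0 addr0.
rewrite !linearP /= addrACA IH; congr (_ + _).
rewrite -scalerDr !tmapE !counitlE counit_scons counit_ssgn_pow /=.
by rewrite scale0r add0r.
Qed.

Lemma counitr_comul (M : lmodType K) (f : {linear symc V -> M}) u :
  counitr f (comul V u) = f u.
Proof.
elim/symc_hind: u M f => [a u v IHu IHv M f|M f|i x u xi IHu M f].
- by rewrite !linearP /= IHu IHv.
- by rewrite comul1 counitrE counit1 scale1r.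
rewrite comul_scons (primitive_mulE _ xi) linearD /=.
rewrite -[RHS](IHu M (f \o scons x)).
elim/tens_ind: (comul V u) => [|c v w t IH]; first by rewrite !raddf0 addr0.
rewrite !linearP /= addrACA IH; congr (_ + _).
by rewrite -scalerDr !tmapE !counitrE counit_scons scale0r addr0.
Qed.

Lemma smul_linr a (x : V) (u v : symc V) :
  scons x (a *: u + v) = a *: scons x u + scons x v.
Proof. exact: linearP. Qed.

Definition smul : {linear tensor V (symc V) -> symc V} :=
  tens_lift (@scons_linear K V) smul_linr.

Lemma smulE x u : smul (tens x u) = scons x u.
Proof. exact: tens_liftE. Qed.

(** Splitting off one letter in all possible ways. This part of the coproduct
    already separates elements without constant term, by [euler]. *)
Definition first_letter : {linear symc V -> tensor V (symc V)} :=
  tmap (sproj V) idfun \o comul V.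

Lemma first_letter1 : first_letter (sym1 V) = 0.
Proof. by rewrite /= comul1 tmapE sproj1 tens0l. Qed.

Lemma sproj_ssgn_pow m u :
  sproj V (ssgn_pow V (odd `|m|%N) u) = gsgn_pow V m (sproj V u).
Proof.
rewrite /ssgn_pow /gsgn_pow; case: odd => //=.
by rewrite (sproj_symc_map (gparity V)).
Qed.

Lemma first_letter_scons i x u : homog i x -> first_letter (scons x u) =
  tens x u + tmap (gsgn_pow V i) (scons x) (first_letter u).
Proof.
move=> xi; rewrite /= comul_scons (primitive_mulE _ xi) linearD /=.
congr (_ + _).
  rewrite -[X in tens _ X](counitl_comul idfun u).
  elim/tens_ind: (comul V u) => [|a v w t IH]; first by rewrite !raddf0 tens0r.
  rewrite !linearP /= IH tensDr; congr (_ *: _ + _).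
  by rewrite !tmapE counitlE sproj_scons tensZr tensZl.
elim/tens_ind: (comul V u) => [|a v w t IH]; first by rewrite !raddf0.
by rewrite !linearP /= IH !tmapE sproj_ssgn_pow.
Qed.

Lemma scons_gsgn_pow i x y u : homog i x ->
  scons (gsgn_pow V i y) (scons x u) = scons x (scons y u).
Proof.
move=> xi; elim/homog_ind: y => [|j y z yj IHz].
  by rewrite raddf0 !scons0 raddf0.
rewrite linearD /= !sconsDl IHz linearD /=; congr (_ + _).
by rewrite (gsgn_powE _ yj) sconsZ (scons_swap _ xi yj).
Qed.

(** Splitting off a letter and putting it back multiplies a word of length n by
    n, as there are n letters to choose. *)
Lemma euler k u :
  smul (tmap idfun (slen V k) (first_letter u)) = k.+1%:R *: slen V k.+1 u.
Proof.
elim/symc_hind: u k => [a u v IHu IHv k|k|i x u xi IHu k].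
- by rewrite !linearP /= IHu IHv !scalerA mulrC.
- by rewrite first_letter1 !raddf0 slen_word scaler0.
rewrite (first_letter_scons _ xi) !linearD /= tmapE smulE slen_scons.
case: k => [|k].
  rewrite scale1r [X in _ + X](_ : _ = 0) ?addr0 //.
  elim/tensD_ind: (tmap _ _ (comul V u)) => [|a v w t IH].
    by rewrite !raddf0.
  by rewrite !linearP IH !tmapE slen0_scons tens0r raddf0 scaler0 addr0.
rewrite [k.+2%:R]mulrS scalerDl scale1r -linearZ /= -IHu /=; congr (_ + _).
elim/tensD_ind: (tmap _ _ (comul V u)) => [|a v w t IH].
  by rewrite !raddf0.
rewrite !linearP /= IH; congr (_ *: _ + _).
by rewrite !tmapE !smulE slen_scons /= scons_gsgn_pow.
Qed.

Lemma first_letter_slen0 u : first_letter (slen V 0 u) = 0.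
Proof. by rewrite slen0 linearZ_LR first_letter1 scaler0. Qed.

Lemma first_letter_slenS k u :
  first_letter (slen V k.+1 u) = tmap idfun (slen V k) (first_letter u).
Proof.
elim/symc_hind: u k => [a u v IHu IHv k|k|i x u xi IHu k].
- by rewrite !linearP -!IHu -!IHv.
- by rewrite first_letter1 slen_word !raddf0.
rewrite slen_scons !(first_letter_scons _ xi) linearD tmapE; congr (_ + _).
case: k => [|k].
  rewrite first_letter_slen0 raddf0.
  elim/tensD_ind: (first_letter u) => [|a v w t IH]; first by rewrite !raddf0.
  by rewrite !linearP -IH !tmapE slen0_scons tens0r scaler0 addr0.
rewrite IHu; elim/tensD_ind: (first_letter u) => [|a v w t IH].
  by rewrite !raddf0.
by rewrite !linearP IH !tmapE slen_scons.
Qed.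

Lemma slen_eq u v : (forall k, slen V k u = slen V k v) -> u = v.
Proof.
move=> uv; have [M uM] := len_below_ex u; have [N vN] := len_below_ex v.
have [-> _] := len_below_leq (leq_maxl M N) uM.
have [-> _] := len_below_leq (leq_maxr M N) vN.
by apply: eq_bigr => k _; apply: uv.
Qed.

End FirstLetter.

Section CoderUnique.
Variables (K : fieldType) (V : gradedSpace K).
Hypothesis charK0 : [pchar K] =i pred0.

Lemma natrS_neq0 n : (n.+1%:R : K) != 0.
Proof. by rewrite (iffLR (pcharf0P K) charK0). Qed.

(** The counit law turns the co-Leibniz rule into
    Q v = (sum of counit (Q v1) v2) + Q v. Hence that sum vanishes, and so does
    its counit, which is the counit of Q v. *)
Lemma counit_coderivation (Q : {linear symc V -> symc V}) u :
  coderivation Q -> counit V (Q u) = 0.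
Proof.
move=> [_ Qc].
have Q0 v : counitl idfun (tmap Q idfun (comul V v)) = 0.
  have := counitl_comul idfun (Q v); rewrite Qc linearD /=.
  have -> : counitl idfun (tmap (ssgn V) Q (comul V v)) = Q v.
    rewrite -[RHS](counitl_comul Q).
    elim/tens_ind: (comul V v) => [|a w z t IH]; first by rewrite !raddf0.
    by rewrite !linearP /= IH tmapE !counitlE counit_ssgn.
  by move=> /eqP; rewrite -subr_eq0 addrK => /eqP.
rewrite -[LHS](counitr_comul (counit V \o Q)).
rewrite -[RHS](raddf0 (counit V)) -(Q0 u).
elim/tens_ind: (comul V u) => [|a w z t IH]; first by rewrite !raddf0.
rewrite !linearP /= IH tmapE counitlE counitrE linearP /=; congr (_ + _).
rewrite (linearZ_LR (counit V)) /=.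
congr (_ *: _); exact: mulrC.
Qed.

(** By [euler] it is enough to compare the images under [first_letter]. There
    the co-Leibniz rule leaves the Taylor coefficients, and values of Q and R on
    words shorter by one letter. *)
Lemma coderivation_unique (Q R : {linear symc V -> symc V}) :
  coderivation Q -> coderivation R -> (forall w, taylor Q w = taylor R w) ->
  Q =1 R.
Proof.
move=> cQ cR QR.
have pQR : forall u, sproj V (Q u) = sproj V (R u).
  exact: (@symc_eq _ _ _ (sproj V \o Q) (sproj V \o R)).
have flE (P : {linear symc V -> symc V}) u : coderivation P ->
    first_letter V (P u) = tmap (sproj V \o P) idfun (comul V u)
                           + tmap (@gsgn K V) P (first_letter V u).
  move=> [_ Pc]; rewrite /= Pc linearD /=; congr (_ + _).
    by rewrite (tmap_comp (k := sproj V \o P) (l := idfun)).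
  have sp v : sproj V (ssgn V v) = gsgn (sproj V v).
    exact: sproj_symc_map (gparity V) v.
  rewrite (tmap_comp (k := sproj V \o ssgn V) (l := P)) //.
  by rewrite (tmap_comp (k := sproj V \o ssgn V) (l := P)) // => v /=.
have key v : tmap (@gsgn K V) Q (first_letter V v)
    = tmap (@gsgn K V) R (first_letter V v) -> Q v = R v.
  move=> QRv; have fQR : first_letter V (Q v) = first_letter V (R v).
    by rewrite !flE // QRv; congr (_ + _); apply: eq_tmap => // z /=.
  apply: slen_eq => -[|j]; first by rewrite !slen0 !counit_coderivation.
  by apply: (scalerI (natrS_neq0 j)); rewrite -!euler fQR.
suff H k u : Q (slen V k u) = R (slen V k u).
  move=> u; have [M [-> _]] := len_below_ex u; rewrite !raddf_sum.
  by apply: eq_bigr => k _; apply: H.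
elim: k u => [|k IH] u; apply: key.
  by rewrite first_letter_slen0 !raddf0.
rewrite first_letter_slenS.
rewrite !(tmap_comp (k := @gsgn K V) (l := Q \o slen V k)) // => v /=.
by rewrite IH.
Qed.

End CoderUnique.

(** * Coalgebra morphisms as convolution exponentials *)

Section Convolution.
Variables (K : fieldType) (V W : gradedSpace K).
Implicit Types f g : {linear symc V -> W}.

Let unit_counit_fun (u : symc V) : symc W := counit V u *: sym1 W.

Let unit_counit_linear : linear unit_counit_fun.
Proof.
by move=> a u v; rewrite /unit_counit_fun linearP scalerDl scalerA.
Qed.

Definition unit_counit : {linear symc V -> symc W} :=
  HB.pack unit_counit_fun
    (GRing.isLinear.Build K _ _ _ unit_counit_fun unit_counit_linear).

(** The k-th convolution power of f, seen as a map S(V) -> S(W); it is the sum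
    over the ways to split a word into k ordered blocks of the product of the
    values of f on the blocks. *)
Fixpoint convpow f k : {linear symc V -> symc W} :=
  if k is k'.+1 then smul W \o tmap f (convpow f k') \o comul V
  else unit_counit.

Lemma convpow0 f u : convpow f 0 u = counit V u *: sym1 W.
Proof. by []. Qed.

Lemma convpowS f k u :
  convpow f k.+1 u = smul W (tmap f (convpow f k) (comul V u)).
Proof. by []. Qed.

Lemma eq_convpow f g k : f =1 g -> convpow f k =1 convpow g k.
Proof.
move=> fg; elim: k => [|k IH] u; first by rewrite !convpow0.
by rewrite !convpowS; congr (smul W _); apply: eq_tmap.
Qed.

(** For F = id this says that the k-th convolution power of the projection
    S(V) -> V is k! times the projection to words of length k, by [euler]. The
    general case follows because F commutes with coproducts. *)
Lemma slen_morphism (F : {linear symc V -> symc W}) k u :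
  coalgebra_morphism F ->
  convpow (sproj W \o F) k u = k`!%:R *: slen W k (F u).
Proof.
move=> [_ Fe Fc]; elim: k u => [|k IH] u.
  by rewrite convpow0 scale1r slen0 Fe.
rewrite convpowS factS mulnC natrM -scalerA -euler /first_letter /= Fc.
rewrite -linearZ /=; congr (smul W _).
elim/tens_ind: (comul V u) => [|a v w t IHt]; first by rewrite !raddf0 ?scaler0.
rewrite !linearP /= IHt !tmapE /= IH tensZr.
by rewrite !scalerA; congr (_ *: _ + _); rewrite mulrC.
Qed.

Lemma morphism_unique (F G : {linear symc V -> symc W}) :
    [pchar K] =i pred0 -> coalgebra_morphism F -> coalgebra_morphism G ->
  (forall w, taylor F w = taylor G w) -> F =1 G.
Proof.
move=> charK0 cF cG FG u; apply: slen_eq => k.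
have [n nE] : exists n, k`! = n.+1 by exists (k`!).-1; rewrite prednK ?fact_gt0.
apply: (scalerI (natrS_neq0 charK0 n)); rewrite -nE -!slen_morphism //.
apply: eq_convpow => {u} u; elim/symc_ind: u => [|a w u IH].
  by rewrite !raddf0.
rewrite !linearP IH; congr (_ *: _ + _); exact: FG.
Qed.

End Convolution.

(** * The automorphism E *)

Section Regroup.
Variables (K : fieldType) (A : gcAlgebra K).
Implicit Types (x y : A) (u v : symc A).

Lemma gmul_linear x : linear (gmul x).
Proof. by move=> a y z; apply: gmulDr. Qed.

HB.instance Definition _ x :=
  GRing.isLinear.Build K A A _ (gmul x) (gmul_linear x).

Lemma gmul0l y : gmul 0 y = 0 :> A.
Proof.
have z : 0 = (-1) *: 0 + 0 :> A by rewrite scaler0 addr0.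
by rewrite [X in gmul X]z gmulDl scaleN1r addNr.
Qed.

Lemma gmulZl a x y : gmul (a *: x) y = a *: gmul x y.
Proof. by rewrite -[a *: x]addr0 gmulDl gmul0l addr0. Qed.

Lemma gmulDDl x y z : gmul (x + y) z = gmul x z + gmul y z.
Proof. by rewrite -[x]scale1r gmulDl !scale1r. Qed.

Lemma gmulr1 x : gmul x (gone A) = x.
Proof.
elim/homog_ind: x => [|i x y xi IHy]; first exact: gmul0l.
by rewrite gmulDDl IHy (gmulC xi (gone_deg A)) mulr0 scale1r gmul1.
Qed.

Lemma mulmap_deg i x j y : homog j y -> homog (j + i) (gmul (gproj A i x) y).
Proof. by move=> yj; rewrite addrC; apply: gmul_deg yj; apply: gproj_id. Qed.

(** Taking the component of degree i makes multiplication by x a map of degree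
    i for every x. *)
Definition mulmap i x : gmap i A A := GMap (@mulmap_deg i x).

Lemma mulmapE i x y : homog i x -> mulmap i x y = gmul x y.
Proof. by rewrite /= => ->. Qed.

(** Multiplies x into each letter in turn. As E has to be defined on words with
    arbitrary letters, x is split into its homogeneous components. *)
Definition graft x u := \sum_(i <- gsupp x) coder (mulmap i x) u.

Lemma graft_linear x : linear (graft x).
Proof.
move=> a u v; rewrite /graft scaler_sumr -big_split /=.
by apply: eq_bigr => i _; rewrite linearP.
Qed.

HB.instance Definition _ x :=
  GRing.isLinear.Build K (symc A) (symc A) _ (graft x) (graft_linear x).

(** A common finite set of degrees makes [graft] visibly linear in x. *)
Lemma graftE s x u : uniq s -> {subset gsupp x <= s} ->
  graft x u = \sum_(i <- s) coder (mulmap i x) u.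
Proof.
move=> s_uniq sub; rewrite (bigID (mem (gsupp x))) /= addrC big1 ?add0r.
  rewrite -big_filter; apply: perm_big; apply: uniq_perm.
  - exact: undup_uniq.
  - exact: filter_uniq.
  move=> i; rewrite mem_filter /=; case: (boolP (i \in gsupp x)) => //= ix.
  by rewrite sub.
move=> i /gproj_supp xi0.
rewrite (@coder_lin _ _ _ _ (mulmap i x) (mulmap i x) (-1)).
  by rewrite scaleN1r addNr.
by move=> y /=; rewrite xi0 gmul0l scaler0 addr0.
Qed.

Lemma graftDl a x y u : graft (a *: x + y) u = a *: graft x u + graft y u.
Proof.
pose s := undup (gsupp (a *: x + y) ++ gsupp x ++ gsupp y).
rewrite !(@graftE s) ?undup_uniq //.
- rewrite scaler_sumr -big_split; apply: eq_bigr => i _ /=.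
  by apply: coder_lin => z /=; rewrite linearP gmulDl.
- by move=> i iz; rewrite mem_undup !mem_cat iz !orbT.
- by move=> i iz; rewrite mem_undup !mem_cat iz !orbT.
- by move=> i iz; rewrite mem_undup mem_cat iz.
Qed.

Lemma graft_homog i x u : homog i x -> graft x u = coder (mulmap i x) u.
Proof.
move=> xi; rewrite (@graftE (undup (i :: gsupp x))) ?undup_uniq //; last first.
  by move=> j jx; rewrite mem_undup inE jx orbT.
rewrite (bigD1_seq i) ?undup_uniq ?mem_undup ?mem_head //=.
rewrite big1 ?addr0 // => j ji.
rewrite (@coder_lin _ _ _ _ (mulmap j x) (mulmap j x) (-1)).
  by rewrite scaleN1r addNr.
by move=> y /=; rewrite (gproj_homog _ xi) (negPf ji) gmul0l scaler0 addr0.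
Qed.

(** One step of E: the new letter x stays alone or joins an existing letter. *)
Definition adjoin x : {linear symc A -> symc A} := scons x \+ graft x.

Lemma adjoinDl a x y u : adjoin (a *: x + y) u = a *: adjoin x u + adjoin y u.
Proof. by rewrite /= scons_linear graftDl scalerDr [LHS]addrACA. Qed.

Lemma adjoin0 u : adjoin 0 u = 0.
Proof.
have := adjoinDl (-1) 0 0 u; rewrite scaler0 addr0 => ->.
by rewrite scaleN1r addNr.
Qed.

Lemma adjoin_homog i x u : homog i x ->
  adjoin x u = scons x u + coder (mulmap i x) u.
Proof. by move=> xi /=; rewrite (graft_homog _ xi). Qed.

(** The operators of inserting and of grafting commute up to sign among
    themselves by graded commutativity of S(A) and of A. The mixed term from
    grafting x into the new letter y is the single letter x y, which is again
    symmetric up to sign. *)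
Lemma adjoin_swap i j x y u : homog i x -> homog j y ->
  adjoin x (adjoin y u) = (-1) ^ (i * j) *: adjoin y (adjoin x u).
Proof.
move=> xi yj; rewrite !(adjoin_homog _ xi) !(adjoin_homog _ yj).
rewrite !raddfD /= (coder_scons _ _ xi) (coder_scons _ _ yj) !mulmapE //.
rewrite (coder_comm (g := mulmap j y)) => [|z]; last first.
  by rewrite !mulmapE // !gmulA (gmulC xi yj) gmulZl.
rewrite (scons_swap _ xi yj) (gmulC xi yj) sconsZ !scalerDr !scalerA.
rewrite [j * i]mulrC signzMM scale1r !addrA; congr (_ + _).
rewrite [LHS](ACl (1*3*4*2)) [RHS](ACl (1*3*2*4)).
by do !congr (_ + _).
Qed.

Definition regroup_word (w : seq A) : symc A := foldr adjoin (sym1 A) w.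

Lemma regroup_cons x w : regroup_word (x :: w) = adjoin x (regroup_word w).
Proof. by []. Qed.

Lemma regroup_word_lin (u : seq A) a x y w :
  regroup_word (u ++ (a *: x + y) :: w) =
  a *: regroup_word (u ++ x :: w) + regroup_word (u ++ y :: w).
Proof.
elim: u => [|z u IH]; first exact: adjoinDl.
by rewrite !cat_cons !regroup_cons IH linearP.
Qed.

Lemma regroup_word_swap (u : seq A) i j x y w : homog i x -> homog j y ->
  regroup_word (u ++ [:: x, y & w]) =
  (-1) ^ (i * j) *: regroup_word (u ++ [:: y, x & w]).
Proof.
move=> xi yj; elim: u => [|z u IH]; first exact: adjoin_swap.
by rewrite !cat_cons !regroup_cons IH linearZ_LR.
Qed.

(** E: the signed sum, over all partitions of the set of letters into blocks,
    of the word formed by the products of the blocks. *)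
Definition regroup : {linear symc A -> symc A} :=
  sym_lift regroup_word_lin regroup_word_swap.

Lemma regroup1 : regroup (sym1 A) = sym1 A.
Proof. exact: sym_liftE. Qed.

Lemma regroup_scons x u : regroup (scons x u) = adjoin x (regroup u).
Proof.
elim/symc_ind: u => [|a w u IH]; first by rewrite !raddf0.
by rewrite !linearP IH sconsE !sym_liftE.
Qed.

Lemma regroup_homog i u : sym_homog i u -> sym_homog i (regroup u).
Proof.
move: i u; apply: sym_homog_rec => [i|i a u v IHu IHv||i j x u xi uj IHu].
- by rewrite raddf0; apply: sym_homog0.
- by rewrite linearP; apply: sym_homogP.
- by rewrite regroup1; apply: sym_homog1.
rewrite regroup_scons (adjoin_homog _ xi); apply: sym_homogD.
  exact: sym_homog_scons.
by rewrite addrC; apply: coder_homog.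
Qed.

Lemma ssgn_regroup u : ssgn A (regroup u) = regroup (ssgn A u).
Proof.
rewrite -[RHS]scale1r; apply: (@degree_ssgn _ _ _ 0) => i v vi.
by rewrite addr0; apply: regroup_homog.
Qed.

(** Each step inserts x with the coproduct of a primitive element and grafts it
    with a coderivation, and both satisfy the same co-Leibniz rule. *)
Lemma regroup_coalgebra : coalgebra_morphism regroup.
Proof.
split; first exact: regroup_homog.
  elim/symc_hind => [a u v IHu IHv||i x u xi IHu].
  - by rewrite !linearP /= IHu IHv.
  - by rewrite regroup1.
  - rewrite regroup_scons (adjoin_homog _ xi) raddfD /= counit_coder.
    by rewrite !counit_scons addr0.
elim/symc_hind => [a u v IHu IHv||i x u xi IHu].
- by rewrite !linearP /= IHu IHv.
- by rewrite regroup1 comul1 tmapE regroup1.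
rewrite regroup_scons (adjoin_homog _ xi) raddfD /= comul_coder !comul_scons.
rewrite IHu.
rewrite !(primitive_mulE _ xi).
pose s := ssgn_pow A (odd `|i|%N); pose D := coder (mulmap i x).
pose T := {linear tensor (symc A) (symc A) -> tensor (symc A) (symc A)}.
pose P : T := tmap (scons x) idfun \+ tmap s (scons x).
pose Q : T := tmap D idfun \+ tmap s D.
pose L : T := (P \+ Q) \o tmap regroup regroup.
pose R : T := tmap regroup regroup \o P.
suff LR : L =1 R by exact: LR.
apply: tensor_eq => v w; rewrite /L /R /P /Q /= !raddfD /= !tmapE /=.
have -> : regroup (s v) = s (regroup v).
  by rewrite /s /ssgn_pow; case: odd => //=; rewrite ssgn_regroup.
rewrite !regroup_scons !(adjoin_homog _ xi) tensDL tensDR.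
exact: addrACA.
Qed.

Lemma taylor_regroup w : taylor regroup w = if nilp w then 0 else gprod w.
Proof.
rewrite /taylor; elim: w => [|x w IH] /=; first by rewrite regroup1 sproj1.
rewrite -sconsE regroup_scons.
have -> : sproj A (adjoin x (regroup (word w))) =
    counit A (word w) *: x + gmul x (sproj A (regroup (word w))).
  have [_ <- _] := regroup_coalgebra; move: (regroup _) => v.
  elim/homog_ind: x => [|i x y xi IHy].
    by rewrite adjoin0 raddf0 scaler0 gmul0l addr0.
  rewrite -[x]scale1r adjoinDl linearP scale1r IHy (adjoin_homog _ xi).
  rewrite linearD /= sproj_scons sproj_coder mulmapE // scale1r.
  by rewrite scalerDr gmulDDl addrACA.
rewrite IH sym_liftE; case: w {IH} => [|y w] /=.
  by rewrite raddf0 addr0 scale1r gmulr1.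
by rewrite scale0r add0r.
Qed.

(** E never lengthens a word, and the only partition that keeps the length is
    the one into singletons. *)
Lemma slen_regroup k j u : (k <= j)%N ->
  slen A j (regroup (slen A k u)) = if k == j then slen A k u else 0.
Proof.
elim/symc_hind: u k j => [a u v IHu IHv k j kj|k j _|i x u xi IHu [|k] [|j] //].
- by rewrite !linearP /= IHu // IHv //; case: eqP; rewrite ?scaler0 ?addr0.
- rewrite slen_word /=; case: k => [|k] /=; last by rewrite !raddf0 if_same.
  by rewrite regroup1 slen_word.
- by rewrite slen0_scons !raddf0.
- by rewrite slen0_scons !raddf0.
rewrite ltnS => kj; rewrite slen_scons regroup_scons (adjoin_homog _ xi).
rewrite linearD /= slen_scons slen_coder IHu // IHu; last exact: ltnW.
rewrite eqSS (ltn_eqF (_ : k < j.+1)%N) // raddf0 addr0.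
by case: eqP; rewrite ?raddf0.
Qed.

Lemma len_below_regroup M u : len_below M.+1 u -> len_below M (u - regroup u).
Proof.
move=> [uE _]; have H k : (M <= k)%N -> slen A k (u - regroup u) = 0.
  move=> Mk; rewrite uE linearB raddf_sum [regroup _]raddf_sum raddf_sum -sumrB.
  apply: big1 => j _ /=; rewrite slenK slen_regroup; last first.
    by apply: leq_trans Mk; rewrite -ltnS.
  by rewrite eq_sym; case: eqP => [->|]; rewrite subrr.
have [N uN] := len_below_ex (u - regroup u).
have [] := len_below_leq (leq_maxr M N) uN.
move: (maxn _ _) (leq_maxl M N) => P MP uP _; split=> //.
rewrite {1}uP -!(big_mkord xpredT (fun k => slen A k _)).
rewrite (big_cat_nat (n := M)) //= [X in _ + X]big1_seq ?addr0 // => k /andP[_].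
by rewrite mem_index_iota => /andP[/H].
Qed.

Lemma regroup_inj0 u : regroup u = 0 -> u = 0.
Proof.
have [M] := len_below_ex u; elim: M u => [|M IH] u uM u0.
  by have [-> _] := uM; rewrite big_ord0.
by have := len_below_regroup uM; rewrite u0 subr0 => /IH; apply.
Qed.

(** Since u - E u is shorter than u, a preimage of u is u plus a preimage of
    u - E u. The predicate P keeps track of properties that this construction
    preserves, such as the degree or the letters. *)
Lemma regroup_surj (P : symc A -> Prop) :
    (forall u v, P u -> P v -> P (u + v)) ->
    (forall u v, P u -> P v -> P (u - v)) ->
    P 0 -> (forall u, P u -> P (regroup u)) ->
  forall u, P u -> exists2 v, P v & regroup v = u.
Proof.
move=> PD PB P0 PR u; have [M] := len_below_ex u; elim: M u => [|M IH] u uM Pu.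
  by exists 0; rewrite ?raddf0 //; have [-> _] := uM; rewrite big_ord0.
have [v Pv vE] := IH _ (len_below_regroup uM) (PB _ _ Pu (PR _ Pu)).
by exists (u + v); [apply: PD | rewrite linearD vE addrC subrK].
Qed.

Lemma regroup_inj : injective regroup.
Proof.
move=> u v uv; apply/eqP; rewrite -subr_eq0; apply/eqP/regroup_inj0.
by rewrite raddfB /= uv subrr.
Qed.

End Regroup.

(** * Koszul brackets and cumulants *)

Lemma theP (T : Type) (x0 : T) (P : T -> Prop) :
  (exists x, P x) -> P (the x0 P).
Proof.
by move=> exP; rewrite /the; case: pselect => // exP'; case: (cid exP').
Qed.

Section KoszulMaps.
Variable K : fieldType.
Hypothesis charK0 : [pchar K] =i pred0.

Section Algebra.
Variable A : gcAlgebra K.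
Implicit Types u v : symc A.

Lemma koszulE_regroup : koszulE A =1 regroup A.
Proof.
have [] : coalgebra_morphism (koszulE A) /\
    forall w, taylor (koszulE A) w = if nilp w then 0 else gprod w.
  apply: (@theP _ _
    (fun E => coalgebra_morphism E /\ forall w, taylor E w = _)).
  exists (regroup A).
  by split; [apply: regroup_coalgebra | apply: taylor_regroup].
move=> cE tE; apply: morphism_unique => // [|w]; first exact: regroup_coalgebra.
by rewrite tE taylor_regroup.
Qed.

Lemma koszulE_bijective :
  exists L : {linear symc A -> symc A},
    cancel (koszulE A) L /\ cancel L (koszulE A).
Proof.
have ex u : exists v, regroup A v = u.
  have [v _ vE] := @regroup_surj _ A (fun=> True) (fun _ _ _ _ => I)
    (fun _ _ _ _ => I) I (fun _ _ => I) u I.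
  by exists v.
pose L u := sval (cid (ex u)).
have LK : cancel L (regroup A) by move=> u; exact: svalP (cid (ex u)).
have L_linear : linear L.
  by move=> a u v; apply: (@regroup_inj _ A); rewrite linearP !LK.
pose Llin : {linear symc A -> symc A} :=
  HB.pack L (GRing.isLinear.Build K _ _ _ L L_linear).
exists Llin.
split=> u /=; last by rewrite koszulE_regroup LK.
by apply: (@regroup_inj _ A); rewrite koszulE_regroup LK.
Qed.

Lemma koszulL_inverse :
  cancel (koszulE A) (koszulL A) /\ cancel (koszulL A) (koszulE A).
Proof.
apply: (@theP _ _ (fun L : {linear symc A -> symc A} =>
  cancel (koszulE A) L /\ cancel L (koszulE A))).
exact: koszulE_bijective.
Qed.

Lemma koszulEK : cancel (koszulE A) (koszulL A).
Proof. by have [] := koszulL_inverse. Qed.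

Lemma koszulLK : cancel (koszulL A) (koszulE A).
Proof. by have [] := koszulL_inverse. Qed.

Lemma koszulE_coalgebra : coalgebra_morphism (koszulE A).
Proof.
have [Rh Re Rc] := regroup_coalgebra A.
split=> [i u ui|u|u]; rewrite !koszulE_regroup ?Rc; [exact: Rh | exact: Re |].
by apply: eq_tmap => v; rewrite koszulE_regroup.
Qed.

Lemma ssgn_koszulE u : ssgn A (koszulE A u) = koszulE A (ssgn A u).
Proof. by rewrite !koszulE_regroup ssgn_regroup. Qed.

(** Properties of E pass to L without a formula for L. *)
Lemma koszulL_closed (P : symc A -> Prop) :
    (forall u v, P u -> P v -> P (u + v)) ->
    (forall u v, P u -> P v -> P (u - v)) ->
    P 0 -> (forall u, P u -> P (regroup A u)) ->
  forall u, P u -> P (koszulL A u).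
Proof.
move=> PD PB P0 PR u /(regroup_surj PD PB P0 PR)[v Pv <-].
by rewrite -koszulE_regroup koszulEK.
Qed.

Lemma koszulL_coalgebra : coalgebra_morphism (koszulL A).
Proof.
have [Eh Ee Ec] := koszulE_coalgebra; split=> [i u|u|u].
- apply: koszulL_closed => [v w|v w||v].
  + exact: sym_homogD.
  + exact: sym_homogB.
  + exact: sym_homog0.
  + exact: regroup_homog.
- by rewrite -Ee koszulLK.
rewrite -{2}[u]koszulLK Ec (tmap_comp (k := idfun) (l := idfun)).
- by rewrite tmap_id.
- exact: koszulEK.
- exact: koszulEK.
Qed.

Lemma koszulE1 : koszulE A (sym1 A) = sym1 A.
Proof. by rewrite koszulE_regroup regroup1. Qed.

Lemma koszulL1 : koszulL A (sym1 A) = sym1 A.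
Proof. by rewrite -{1}koszulE1 koszulEK. Qed.

Lemma koszulE_letter x : koszulE A (word [:: x]) = word [:: x].
Proof.
rewrite koszulE_regroup -[[:: x]]/(x :: [::]) -sconsE regroup_scons regroup1 /=.
rewrite /graft big1 ?addr0 // => i _; exact: coder1.
Qed.

Lemma koszulL_letter x : koszulL A (word [:: x]) = word [:: x].
Proof. by rewrite -{1}koszulE_letter koszulEK. Qed.

Lemma coder_coderivation (Delta : gmap 1 A A) : coderivation (coder Delta).
Proof.
by split=> [i u|u]; [exact: coder_homog | rewrite comul_coder].
Qed.

Lemma linear_coderivationE (Delta : gmap 1 A A) :
  linear_coderivation Delta =1 coder Delta.
Proof.
have tcoder w : taylor (coder Delta) w = Delta (if w is [:: a] then a else 0).
  by rewrite /taylor sproj_coder sym_liftE.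
have [cQ tQ1 tQ] : [/\ coderivation (linear_coderivation Delta),
    forall a, taylor (linear_coderivation Delta) [:: a] = Delta a
  & forall w, size w != 1%N -> taylor (linear_coderivation Delta) w = 0].
  apply: (@theP _ _ (fun Q => [/\ coderivation Q, forall a, taylor Q [:: a] = _
                           & forall w, _ -> taylor Q w = _])).
  exists (coder Delta); split; first exact: coder_coderivation.
    by move=> a; rewrite tcoder.
  by move=> [|a [|b w]] // _; rewrite tcoder raddf0.
apply: coderivation_unique => //; first exact: coder_coderivation.
by move=> [|a [|b w]]; rewrite ?tQ1 ?tQ // tcoder ?raddf0.
Qed.

Lemma koszul_bracketsE (Delta : gmap 1 A A) u :
  koszul_brackets Delta u = koszulL A (coder Delta (koszulE A u)).
Proof. by rewrite /koszul_brackets /= linear_coderivationE. Qed.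

(** D D = - D D by [coder_comm], and 2 is invertible. *)
Lemma coder_square (Delta : gmap 1 A A) u :
  (forall a, Delta (Delta a) = 0) -> coder Delta (coder Delta u) = 0.
Proof.
move=> DD; have /eqP : coder Delta (coder Delta u)
    = (-1) ^ (1 * 1) *: coder Delta (coder Delta u).
  by apply: coder_comm => a; rewrite DD scaler0.
rewrite mulr1 expr1z scaleN1r -subr_eq0 opprK -mulr2n -scaler_nat scaler_eq0.
by rewrite (negPf (natrS_neq0 charK0 1)) => /eqP.
Qed.

Lemma koszul_brackets_linfty (Delta : gmap 1 A A) :
  (forall a, Delta (Delta a) = 0) -> linfty_structure (koszul_brackets Delta).
Proof.
move=> DD; have [Eh Ee Ec] := koszulE_coalgebra.
have [Lh Le Lc] := koszulL_coalgebra.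
split; [split=> [i u ui|u] | |move=> u]; rewrite ?koszul_bracketsE.
- by apply/Lh/coder_homog/Eh.
- rewrite Lc comul_coder linearD Ec /=; congr (_ + _).
    apply: tmap_comp3 => v; first by rewrite koszul_bracketsE.
    exact: koszulEK.
  apply: tmap_comp3 => v; last by rewrite koszul_bracketsE.
  by rewrite -[RHS]koszulEK ssgn_koszulE.
- by rewrite koszulE1 coder1 raddf0.
- by rewrite koszulLK coder_square // raddf0.
Qed.

Lemma koszulE_letters (C : A -> Prop) u :
    (forall x y, C x -> C y -> C (gmul x y)) ->
  letters_in C u -> letters_in C (koszulE A u).
Proof.
move=> CM; rewrite koszulE_regroup.
elim=> [a v w _ IHv _ IHw||i x v xi Cx _ IHv].
- by rewrite linearP; apply: LettersLin.
- by rewrite regroup1; apply: Letters1.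
rewrite regroup_scons (adjoin_homog _ xi); apply: letters_inD.
  exact: LettersCons xi Cx IHv.
by apply: coder_letters => // y Cy; rewrite mulmapE //; apply: CM.
Qed.

Lemma koszulL_letters (C : A -> Prop) u :
    (forall x y, C x -> C y -> C (gmul x y)) ->
  letters_in C u -> letters_in C (koszulL A u).
Proof.
move=> CM; apply: koszulL_closed => [v w|v w||v].
- exact: letters_inD.
- exact: letters_inB.
- exact: letters_in0.
- by rewrite -koszulE_regroup; apply: koszulE_letters.
Qed.

Lemma sproj_letters (C : A -> Prop) u :
    C 0 -> (forall a x y, C x -> C y -> C (a *: x + y)) ->
  letters_in C u -> C (sproj A u).
Proof.
move=> C0 CL; elim=> [a v w _ IHv _ IHw||i x v xi Cx _ IHv].
- by rewrite linearP; apply: CL.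
- by rewrite sproj1.
- by rewrite sproj_scons -[_ *: _]addr0; apply: CL.
Qed.

End Algebra.

Lemma comp_coalgebra (U V W : gradedSpace K) (F : {linear symc V -> symc W})
    (G : {linear symc U -> symc V}) :
  coalgebra_morphism F -> coalgebra_morphism G -> coalgebra_morphism (F \o G).
Proof.
move=> [Fh Fe Fc] [Gh Ge Gc]; split=> [i u ui|u|u] /=.
- exact/Fh/Gh.
- by rewrite Fe Ge.
- by rewrite Fc Gc; apply: tmap_comp.
Qed.

Section Cumulants.
Variables (A B : gcAlgebra K) (f : gmap 0 A B).

Lemma cumulantE u : cumulant f u = koszulL B (symc_map f (koszulE A u)).
Proof. by []. Qed.

Lemma cumulant_coalgebra : coalgebra_morphism (cumulant f).
Proof.
apply: comp_coalgebra; last exact: koszulE_coalgebra.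
apply: comp_coalgebra; first exact: koszulL_coalgebra.
exact: symc_map_coalgebra.
Qed.

Lemma cumulant1 : cumulant f (sym1 A) = sym1 B.
Proof. by rewrite cumulantE koszulE1 symc_map1 koszulL1. Qed.

Lemma cumulant_letter x : cumulant f (word [:: x]) = word [:: f x].
Proof. by rewrite cumulantE koszulE_letter symc_mapE koszulL_letter. Qed.

Lemma cumulant_brackets (dA : gmap 1 A A) (dB : gmap 1 B B) u :
    (forall a, f (dA a) = dB (f a)) ->
  cumulant f (koszul_brackets dA u) = koszul_brackets dB (cumulant f u).
Proof.
move=> fd; rewrite !koszul_bracketsE !cumulantE !koszulLK; congr (koszulL B _).
apply: (symc_map_coder (C := fun=> True)) => [x _|]; first exact: fd.
exact: letters_in_all.
Qed.

Lemma cumulant_letters (C : B -> Prop) u :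
    (forall x, C (f x)) -> (forall x y, C x -> C y -> C (gmul x y)) ->
  letters_in C (cumulant f u).
Proof.
move=> Cf CM; rewrite cumulantE; apply: koszulL_letters => //.
elim/symc_hind: (koszulE A u) => [a v w IHv IHw||i x v xi IHv].
- by rewrite linearP; apply: LettersLin.
- by rewrite symc_map1; apply: Letters1.
- by rewrite symc_map_scons; apply: LettersCons (gmap0_homog f xi) (Cf x) IHv.
Qed.

(** E is natural for multiplicative maps; only the letters that occur matter,
    so it suffices that f be multiplicative on a subspace C containing them and
    closed under products. *)
Lemma symc_map_koszulE (C : A -> Prop) u :
    (forall x y, C x -> C y -> C (gmul x y)) ->
    (forall x y, C x -> C y -> f (gmul x y) = gmul (f x) (f y)) ->
  letters_in C u -> symc_map f (koszulE A u) = koszulE B (symc_map f u).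
Proof.
move=> CM fM Cu; suff [] : letters_in C (koszulE A u) /\
  symc_map f (koszulE A u) = koszulE B (symc_map f u) by [].
elim: Cu => [a v w _ [Cv IHv] _ [Cw IHw]||i x v xi Cx Cv [CEv IHv]].
- by rewrite !linearP /= IHv IHw; split=> //; apply: LettersLin.
- by rewrite symc_map1 !koszulE1 symc_map1; split=> //; apply: Letters1.
split; first by apply: koszulE_letters CM (LettersCons xi Cx Cv).
have fx := gmap0_homog f xi.
rewrite symc_map_scons !koszulE_regroup !regroup_scons (adjoin_homog _ xi).
rewrite (adjoin_homog _ fx) -!koszulE_regroup -IHv linearD /= symc_map_scons.
congr (_ + _); apply: (symc_map_coder (C := C)) CEv => y Cy.
by rewrite !mulmapE // fM.
Qed.

End Cumulants.

(** E S(sigma) kappa(tau) = S(sigma) E L S(tau) E = S(sigma tau) E = E, and E is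
    injective. *)
Lemma symc_map_cumulant (A B : gcAlgebra K) (C : A -> Prop)
    (sigma : gmap 0 A B) (tau : gmap 0 B A) u :
    (forall x y, C x -> C y -> C (gmul x y)) ->
    (forall x y, C x -> C y -> sigma (gmul x y) = gmul (sigma x) (sigma y)) ->
    (forall x, C (tau x)) -> (forall x, sigma (tau x) = x) ->
  symc_map sigma (cumulant tau u) = u.
Proof.
move=> CM sM Ct st; apply: (can_inj (@koszulEK B)).
rewrite -(symc_map_koszulE CM sM); last exact: cumulant_letters.
rewrite cumulantE koszulLK.
elim/symc_hind: (koszulE B u) => [a v w IHv IHw||i x v xi IHv].
- by rewrite !linearP /= IHv IHw.
- by rewrite !symc_map1.
- by rewrite !symc_map_scons IHv st.
Qed.

End KoszulMaps.

(** * Unshuffles as lists of blocks *)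

Section Blocks.
Variable n : nat.
Local Notation T := 'I_n.
Implicit Types (s t : seq T) (p : seq T * seq T) (bl : seq (seq T)).

Definition before : rel T := fun i j => (i < j)%N.
Local Notation increasing := (pairwise before).

Fixpoint splits s : seq (seq T * seq T) :=
  if s is i :: s' then [seq (i :: p.1, p.2) | p <- splits s']
                       ++ [seq (p.1, i :: p.2) | p <- splits s']
  else [:: ([::], [::])].

Lemma before_irr i : before i i = false.
Proof. exact: ltnn. Qed.

Lemma before_trans : transitive before.
Proof. by move=> j i k; apply: ltn_trans. Qed.

Lemma increasing_uniq s : increasing s -> uniq s.
Proof.
by move=> s_inc; apply: (pairwise_uniq before_irr).
Qed.

Lemma increasing_min i q : increasing q -> i \in q ->
  (forall j, j \in q -> (j == i) || before i j) -> exists a, q = i :: a.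
Proof.
case: q => // j a /= /andP[/allP ja _].
rewrite inE => /predU1P[<- _|ia min]; first by exists a.
have ji := ja _ ia; case/predU1P: (min j (mem_head _ _)) => [jE|ij].
  by rewrite jE before_irr in ji.
by have := ltn_trans ij ji; rewrite ltnn.
Qed.

(** The first letter of s is its minimum, so it must come first in whichever
    half contains it. *)
Lemma mem_splits s p : increasing s -> (p \in splits s) =
  [&& increasing p.1, increasing p.2 & perm_eq (p.1 ++ p.2) s].
Proof.
elim: s p => [|i s IH] [a b] /=.
  move=> _; rewrite inE xpair_eqE.
  apply/andP/and3P => [[/eqP-> /eqP->] //|[_ _]].
  by move/perm_size; rewrite size_cat; case: a b => [|j a] [|l b].
move=> /andP[/allP i_s /[dup] s_inc /IH{}IH].
have consr (c e : seq T) : perm_eq (c ++ i :: e) (i :: s) = perm_eq (c ++ e) s.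
  by rewrite -(cat1s i e) perm_catCA /= perm_cons.
rewrite mem_cat; apply/orP/and3P => [[]|[a_inc b_inc ab]].
- case/mapP => -[a' b'] /=; rewrite IH => /and3P[/= a_inc b_inc ab] [-> ->] /=.
  split=> //; last by rewrite perm_cons.
  rewrite a_inc andbT; apply/allP => j ja; apply: i_s.
  by rewrite -(perm_mem ab) mem_cat ja.
- case/mapP => -[a' b'] /=; rewrite IH => /and3P[/= a_inc b_inc ab] [-> ->] /=.
  split=> //; last by rewrite consr.
  rewrite b_inc andbT; apply/allP => j jb; apply: i_s.
  by rewrite -(perm_mem ab) mem_cat jb orbT.
have min q : {subset q <= a ++ b} ->
    forall j, j \in q -> (j == i) || before i j.
  move=> sub j /sub; rewrite (perm_mem ab) inE => /orP[->//|/i_s ->].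
  exact: orbT.
have := perm_mem ab i; rewrite mem_cat mem_head => /orP[ia|ib].
  have [|a' aE] := increasing_min a_inc ia.
    by apply: min => j ja; rewrite mem_cat ja.
  left; apply/mapP; exists (a', b); rewrite ?aE // IH /=.
  move: a_inc ab; rewrite aE /= => /andP[_ ->]; rewrite perm_cons => ->.
  by rewrite b_inc.
have [|b' bE] := increasing_min b_inc ib.
  by apply: min => j jb; rewrite mem_cat jb orbT.
right; apply/mapP; exists (a, b'); rewrite ?bE // IH /=.
move: b_inc ab; rewrite bE /= => /andP[_ ->].
by rewrite consr a_inc => ->.
Qed.

Lemma uniq_splits s : increasing s -> uniq (splits s).
Proof.
elim: s => //= i s IH /andP[/allP i_s s_inc].
rewrite cat_uniq !map_inj_uniq ?IH //=.
- rewrite andbT; apply/hasPn => _ /mapP[p ps ->]; apply/mapP => -[q _ [pE _]].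
  move: ps; rewrite mem_splits // => /and3P[_ _ /perm_mem /(_ i)].
  by rewrite pE /= mem_head => /esym /i_s; rewrite before_irr.
- by move=> [a b] [a' b'] [-> ->].
- by move=> [a b] [a' b'] [-> ->].
Qed.

(** The ordered decompositions of s into k increasing blocks, empty ones
    allowed. An unshuffle pi of type c is such a decomposition of 0, ..., n - 1
    into nonempty blocks: cut the sequence of the values of pi at the sizes
    given by c. *)
Fixpoint blocks k s : seq (seq (seq T)) :=
  if k is k'.+1 then [seq p.1 :: bl | p <- splits s, bl <- blocks k' p.2]
  else if nilp s then [:: [::]] else [::].

Lemma mem_blocks k s bl : increasing s -> (bl \in blocks k s) =
  [&& size bl == k, all increasing bl & perm_eq (flatten bl) s].
Proof.
elim: k s bl => [|k IH] s bl s_inc /=.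
  case: bl => [|b bl] /=; last by case: nilp.
  by case: s {s_inc} => //= i s; rewrite in_nil; apply/esym/negP => /perm_size.
apply/allpairsPdep/and3P => [[p [bl' [ps blp ->]]]|[]].
  move: ps blp; rewrite mem_splits // => /and3P[p1 p2 ps].
  rewrite IH // => /and3P[/= /eqP -> -> bl'p]; split; rewrite ?p1 //.
  by apply: perm_trans ps; rewrite perm_cat2l.
case: bl => // b bl /=; rewrite eqSS => size_bl /andP[b_inc bl_inc] bls.
pose c := [seq i <- s | i \notin b].
have s_uniq := increasing_uniq s_inc.
have := perm_uniq bls; rewrite s_uniq cat_uniq.
move=> /and3P[b_uniq /hasPn b_bl bl_uniq].
have blc : perm_eq (flatten bl) c.
  apply: uniq_perm; rewrite ?filter_uniq // => i.
  rewrite mem_filter -(perm_mem bls) mem_cat.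
  by case: (boolP (i \in b)) => //= ib; apply/negP => /b_bl /negP[].
have c_inc : increasing c by apply: subseq_pairwise s_inc; apply: filter_subseq.
exists (b, c), bl; split=> //; last by rewrite IH //= size_bl bl_inc.
rewrite mem_splits //= b_inc c_inc; apply: perm_trans bls.
by rewrite perm_cat2l perm_sym.
Qed.

Lemma uniq_blocks k s : increasing s -> uniq (blocks k s).
Proof.
elim: k s => [|k IH] s s_inc /=; first by case: nilp.
apply: allpairs_uniq_dep => [|p|].
- exact: uniq_splits.
- by rewrite mem_splits // => /and3P[_ p2 _]; apply: IH.
move=> [p bl] [q bl'] /allpairsPdep[p' [c [p's cp' [-> ->]]]].
move=> /allpairsPdep[q' [c' [q's cq' [-> ->]]]] /= [p1 cc'].
have [/and3P[_ p'2 _] /and3P[_ q'2 _]] :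
  [&& increasing p'.1, increasing p'.2 & perm_eq (p'.1 ++ p'.2) s] /\
  [&& increasing q'.1, increasing q'.2 & perm_eq (q'.1 ++ q'.2) s].
  by rewrite -!mem_splits.
have p2 : p'.2 = q'.2.
  apply: (irr_sorted_eq before_trans before_irr (pairwise_sorted p'2)
    (pairwise_sorted q'2)) => i.
  move: cp' cq'; rewrite !mem_blocks // cc'.
  by move=> /and3P[_ _ /perm_mem <-] /and3P[_ _ /perm_mem <-].
rewrite cc'; move: p' q' p1 p2 {p's q's cp' cq' p'2 q'2}.
by move=> [a b] [a' b'] /= -> ->.
Qed.

End Blocks.

Section KoszulSigns.
Variables (K : fieldType) (n : nat) (d : 'I_n -> int).
Local Notation T := 'I_n.
Local Notation increasing := (pairwise (@before n)).
Implicit Types (s t : seq T) (i j : T).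

(** The sign for moving t in front of s, restricted to the inversions between
    them. *)
Definition cross s t : K :=
  \prod_(i <- s) \prod_(j <- t | before j i) (-1) ^ (d i * d j).

(** The Koszul sign of a sequence of indices, defined by counting inversions
    letter by letter, so that it can be computed along the recursion of
    [blocks]. *)
Fixpoint seq_sign s : K :=
  if s is i :: s' then cross [:: i] s' * seq_sign s' else 1.

Lemma cross_cons i s t : cross (i :: s) t = cross [:: i] t * cross s t.
Proof. by rewrite /cross big_cons big_seq1. Qed.

Lemma cross_cat s t1 t2 : cross s (t1 ++ t2) = cross s t1 * cross s t2.
Proof.
by rewrite /cross -big_split; apply: eq_bigr => i _; rewrite big_cat.
Qed.

Lemma cross_perm s t1 t2 : perm_eq t1 t2 -> cross s t1 = cross s t2.
Proof. by move=> t12; apply: eq_bigr => i _; apply: perm_big. Qed.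

Lemma cross1_min i s : all (before i) s -> cross [:: i] s = 1.
Proof.
move=> /allP i_s; rewrite /cross big_seq1 big_seq_cond big1 // => j.
move=> /andP[/i_s ij ji].
by have := before_trans ij ji; rewrite before_irr.
Qed.

Lemma seq_sign_cat s t :
  seq_sign (s ++ t) = seq_sign s * cross s t * seq_sign t.
Proof.
elim: s => [|i s IH] /=; first by rewrite /cross big_nil !mul1r.
rewrite IH (cross_cons i s t) cross_cat !mulrA; congr (_ * _ * _).
exact: mulrAC.
Qed.

Lemma seq_sign_increasing s : increasing s -> seq_sign s = 1.
Proof.
elim: s => //= i s IH /andP[i_s s_inc].
by rewrite cross1_min // IH // mulr1.
Qed.

Lemma seq_sign_perm (pi : 'S_n) s : increasing s ->
  \prod_(i <- s) \prod_(j <- s | (i < j)%N && (pi j < pi i)%N)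
     (-1) ^ (d (pi i) * d (pi j)) = seq_sign [seq pi i | i <- s].
Proof.
elim: s => [|i s IH] /=; first by rewrite big_nil.
move=> /andP[/allP i_s s_inc]; rewrite big_cons -IH //; congr (_ * _).
  rewrite big_cons ltnn /= /cross big_seq1 big_map.
  rewrite big_seq_cond [RHS]big_seq_cond; apply: eq_bigl => j.
  by case: (boolP (j \in s)) => //= /i_s; rewrite /before => ->.
rewrite big_seq [RHS]big_seq; apply: eq_bigr => j js; rewrite big_cons.
by have := i_s _ js; rewrite /before => ij; rewrite ltnNge (ltnW ij).
Qed.

Lemma perm_index_enum_ord : perm_eq (index_enum T) (enum T).
Proof.
apply: uniq_perm; rewrite ?index_enum_uniq ?enum_uniq // => i.
by rewrite mem_index_enum mem_enum.
Qed.

Lemma increasing_enum : increasing (enum T).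
Proof.
rewrite -sorted_pairwise; last exact: before_trans.
by have := iota_ltn_sorted 0 n; rewrite -val_enum_ord sorted_map.
Qed.

Lemma koszul_signE (pi : 'S_n) :
  koszul_sign K d pi = seq_sign [seq pi i | i <- enum T].
Proof.
rewrite -seq_sign_perm; last exact: increasing_enum.
rewrite /koszul_sign (perm_big _ perm_index_enum_ord) /=.
by apply: eq_bigr => i _; apply: perm_big; apply: perm_index_enum_ord.
Qed.

End KoszulSigns.

(** * Expansion of coalgebra morphisms over blocks *)

Section Expansion.
Variables (K : fieldType) (n : nat) (d : 'I_n -> int).
Variables (V W : gradedSpace K) (x : 'I_n -> V).
Hypothesis xd : forall i, homog (d i) (x i).
Local Notation T := 'I_n.
Local Notation increasing := (pairwise (@before n)).
Implicit Types (s t : seq T) (i j : T).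

Local Notation wordx s := (word (map x s)).

Lemma ssgn_pow_wordx i s : ssgn_pow V (odd `|d i|%N) (wordx s) =
  (\prod_(k <- s) (-1) ^ (d i * d k)) *: wordx s.
Proof.
elim: s => [|k s IH] /=.
  by rewrite big_nil scale1r /ssgn_pow; case: odd; rewrite //= symc_mapE.
rewrite -sconsE (ssgn_pow_scons _ _ (xd k)) IH linearZ_LR /= scalerA big_cons.
by rewrite expN1z abszM oddM.
Qed.

(** A letter put into the right half passes the letters of the left half, all
    of which come later; these are exactly the new inversions. *)
Lemma comul_wordx s : increasing s -> comul V (wordx s) =
  \sum_(p <- splits s) cross K d p.1 p.2 *: tens (wordx p.1) (wordx p.2).
Proof.
elim: s => [_|i s IH] /=.
  by rewrite comul1 big_seq1 /cross big_nil scale1r.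
move=> /andP[/allP i_s s_inc]; rewrite -sconsE comul_scons IH // raddf_sum.
rewrite big_cat !big_map.
rewrite /= -big_split /= big_seq [RHS]big_seq; apply: eq_bigr => -[a b].
rewrite mem_splits // => /and3P[/= _ _ ab].
have ia : all (before i) a.
  by apply/allP => j ja; apply: i_s; rewrite -(perm_mem ab) mem_cat ja.
have ib : all (before i) b.
  by apply/allP => j jb; apply: i_s; rewrite -(perm_mem ab) mem_cat jb orbT.
rewrite linearZ_LR /= (primitive_mulE _ (xd i)) !tmapE !sconsE /= scalerDr.
rewrite (cross_cons _ _ i a) (cross1_min _ _ ib) mul1r; congr (_ + _).
rewrite ssgn_pow_wordx tensZl scalerA mulrC; congr (_ *: _).
rewrite -(cat1s i b) cross_cat; congr (_ * _).
rewrite /cross big_seq [RHS]big_seq.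
apply: eq_bigr => j ja; rewrite big_mkcond big_seq1.
by rewrite (allP ia) // mulrC.
Qed.

Variable f : {linear symc V -> W}.

Lemma convpow_blocks k s : increasing s -> convpow f k (wordx s) =
  \sum_(bl <- blocks k s)
    seq_sign K d (flatten bl) *: word [seq f (wordx b) | b <- bl].
Proof.
elim: k s => [|k IH] s s_inc.
  rewrite convpow0 sym_liftE /=; case: s s_inc => [|i s] _ /=.
    by rewrite big_seq1 /= scale1r.
  by rewrite big_nil scale0r.
rewrite convpowS comul_wordx // !raddf_sum /= big_allpairs_dep.
rewrite big_seq [RHS]big_seq; apply: eq_bigr => -[a b] /=.
rewrite mem_splits // => /and3P[/= a_inc b_inc _].
rewrite !linearZ_LR /= tmapE smulE IH // raddf_sum scaler_sumr.
rewrite big_seq [RHS]big_seq; apply: eq_bigr => bl.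
rewrite mem_blocks // => /and3P[_ _ bl_b].
rewrite /= linearZ_LR /= sconsE scalerA seq_sign_cat.
rewrite (seq_sign_increasing _ _ a_inc).
by rewrite mul1r (cross_perm _ _ _ bl_b).
Qed.

End Expansion.

Section Unshuffles.
Variables (n : nat) (U : nmodType) (F : seq (seq 'I_n) -> U).
Hypothesis F0 : forall bl, [::] \in bl -> F bl = 0.
Local Notation T := 'I_n.

Lemma unshuffleE (c : seq nat) (pi : 'S_n) : unshuffle c pi =
  all (pairwise (@before n)) (reshape c [seq pi i | i <- enum T]).
Proof.
rewrite /unshuffle (map_comp val pi) -map_reshape all_map.
apply: eq_all => b /=.
by rewrite sorted_map sorted_pairwise //; apply: before_trans.
Qed.

(** Reindexing along (c, pi) |-> reshape c (pi 0, ..., pi (n - 1)), with inverse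
    bl |-> (shape bl, flatten bl). *)
Lemma sum_unshuffles k :
  \sum_(c : k.-tuple 'I_n.+1 |
          (0%N \notin map val c) && (sumn (map val c) == n))
  \sum_(pi : 'S_n | unshuffle (map val c) pi)
    F (reshape (map val c) [seq pi i | i <- enum T])
  = \sum_(bl <- blocks k (enum T)) F bl.
Proof.
rewrite [RHS](bigID (fun bl : seq (seq T) => [::] \in bl)) /=.
rewrite [X in _ = X + _]big1 ?add0r //.
rewrite pair_big_dep /= -[LHS]big_filter -[RHS]big_filter.
pose h (q : k.-tuple 'I_n.+1 * 'S_n) :=
  reshape (map val q.1) [seq q.2 i | i <- enum T].
rewrite -(big_map h xpredT F); apply: perm_big; apply: uniq_perm.
- rewrite map_inj_in_uniq ?filter_uniq ?index_enum_uniq // => -[c pi] [c' pi'].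
  rewrite !mem_filter /= => /andP[/andP[/andP[_ /eqP cn] _] _].
  move=> /andP[/andP[/andP[_ /eqP c'n] _] _]; rewrite /h /= => hE.
  have size_pi (p : 'S_n) : size [seq p i | i <- enum T] = n.
    by rewrite size_map size_enum_ord.
  congr (_, _).
    apply: val_inj; apply: (inj_map val_inj).
    rewrite -(reshapeKl (_ : (sumn (map val c)
                                <= size [seq pi i | i <- enum T])%N)).
      by rewrite hE reshapeKl // c'n size_pi.
    by rewrite cn size_pi.
  have : [seq pi i | i <- enum T] = [seq pi' i | i <- enum T].
    rewrite -(reshapeKr (_ : (size [seq pi i | i <- enum T]
                                <= sumn (map val c))%N)).
      by rewrite hE reshapeKr // c'n size_pi.
    by rewrite cn size_pi.
  by move=> /eq_in_map piE; apply/permP => i; apply: piE; rewrite mem_enum.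
- by rewrite filter_uniq // uniq_blocks // increasing_enum.
move=> bl; rewrite mem_filter mem_blocks; last exact: increasing_enum.
apply/mapP/idP => [[[c pi]]|].
  rewrite mem_filter /= => /andP[/andP[/andP[c0 /eqP cn] c_pi] _] ->.
  rewrite /h /=.
  have size_pi : size [seq pi i | i <- enum T] = n.
    by rewrite size_map size_enum_ord.
  have shE : shape (reshape (map val c) [seq pi i | i <- enum T]) = map val c.
    by rewrite reshapeKl // cn size_pi.
  rewrite -unshuffleE c_pi /= reshapeKr ?cn ?size_pi //.
  rewrite -(size_map size) -/(shape _) shE size_map size_tuple eqxx /=.
  apply/andP; split.
    by apply: contra c0 => /(map_f size); rewrite -/(shape _) shE.
  apply: uniq_perm; rewrite ?enum_uniq //.
    by rewrite (map_inj_uniq (@perm_inj _ pi)) enum_uniq.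
  move=> i; rewrite mem_enum; apply/mapP.
  exists ((pi^-1)%g i); rewrite ?mem_enum //.
  by rewrite permKV.
move=> /andP[bl0 /and3P[/eqP blk bl_inc bl_enum]].
have size_fl : size (flatten bl) = n.
  by rewrite (perm_size bl_enum) size_enum_ord.
have shape_lt b : b \in bl -> (size b < n.+1)%N.
  move=> bbl; rewrite ltnS -[leqRHS]size_fl size_flatten /shape.
  by rewrite sumnE big_map (big_rem b) //= leq_addr.
have c_size : size (map (fun b => inord (size b) : 'I_n.+1) bl) == k.
  by rewrite size_map blk.
pose c := Tuple c_size.
have cE : map val c = shape bl.
  by rewrite /= -map_comp; apply/eq_in_map => b /shape_lt bn /=; rewrite inordK.
have fl_uniq : uniq (flatten bl) by rewrite (perm_uniq bl_enum) enum_uniq.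
(* The default value i is harmless: flatten bl has n entries. *)
pose g (i : T) := nth i (flatten bl) i.
have g_inj : injective g.
  move=> i j /eqP; rewrite /g (set_nth_default j) ?size_fl //.
  rewrite nth_uniq ?size_fl //.
  by move=> /eqP/val_inj.
have piE : [seq perm g_inj i | i <- enum T] = flatten bl.
  have size_pi : size [seq perm g_inj i | i <- enum T] = size (flatten bl).
    by rewrite size_map size_enum_ord size_fl.
  case fl: (flatten bl) size_pi => [|i0 s] size_pi; first exact: size0nil.
  apply: (@eq_from_nth _ i0) => // j; rewrite size_map size_enum_ord => jn.
  rewrite (nth_map i0) ?size_enum_ord // permE /g.
  rewrite -[j]/(val (Ordinal jn)) nth_ord_enum fl.
  by apply: set_nth_default; rewrite -fl size_fl.
exists (c, perm g_inj); last by rewrite /h /= cE piE flattenK.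
rewrite mem_filter mem_index_enum /= cE andbT unshuffleE piE flattenK bl_inc.
rewrite andbT -size_flatten size_fl eqxx andbT.
by apply: contra bl0 => /mapP[b bbl /esym/size0nil <-].
Qed.

End Unshuffles.

(** * The transfer sums *)

Section Transfer.
Variable K : fieldType.
Hypothesis charK0 : [pchar K] =i pred0.

Lemma word_letter0 (V : gradedSpace K) (w : seq V) : 0 \in w -> word w = 0.
Proof.
case/splitPr => u v; have z : 0 = (-1) *: 0 + 0 :> V by rewrite scaler0 addr0.
by rewrite {1}z wordP scaleN1r addNr.
Qed.

Lemma size_flatten_ge (T : eqType) (bl : seq (seq T)) :
  [::] \notin bl -> (size bl <= size (flatten bl))%N.
Proof.
elim: bl => //= b bl IH; rewrite inE negb_or size_cat -add1n => /andP[b0 /IH].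
by apply: leq_add; rewrite lt0n size_eq0 eq_sym.
Qed.

Variables (V W : gradedSpace K) (F : {linear symc W -> symc V}).
Hypotheses (cF : coalgebra_morphism F) (F1 : F (sym1 W) = sym1 V).
Variables (n : nat) (d : 'I_n -> int) (x : 'I_n -> W).
Hypothesis xd : forall i, homog (d i) (x i).

Let Fx (b : seq 'I_n) : V := taylor F (map x b).
Let w := word (map x (enum 'I_n)).

(** The component of length k of a coalgebra morphism, in terms of its Taylor
    coefficients. *)
Lemma slen_blocks k : slen V k (F w) =
  \sum_(bl <- blocks k (enum 'I_n))
    (seq_sign K d (flatten bl) / k`!%:R) *: word (map Fx bl).
Proof.
have [m mE] : exists m, k`! = m.+1 by exists (k`!).-1; rewrite prednK ?fact_gt0.
have k0 : (k`!%:R : K) != 0 by rewrite mE natrS_neq0.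
apply: (scalerI k0); rewrite -(slen_morphism _ _ cF).
rewrite (convpow_blocks xd) ?increasing_enum //.
rewrite scaler_sumr; apply: eq_bigr => bl _.
by rewrite scalerA mulrCA divff // mulr1.
Qed.

Lemma word_Fx0 bl : [::] \in bl -> word (map Fx bl) = 0.
Proof.
move=> bl0; apply: word_letter0; apply/mapP; exists [::] => //.
by rewrite /Fx /= /taylor F1 sproj1.
Qed.

(** F w has no component of length 0, as w is not empty, nor of length greater
    than n, since more than n blocks of n letters include an empty one, on which
    the Taylor coefficient of F vanishes. *)
Lemma higher_part : (0 < n)%N ->
  \sum_(2 <= k < n.+1) slen V k (F w)
  = F w - word [:: taylor F (map x (enum 'I_n))].
Proof.
move=> n_gt0; have big_k k : (n < k)%N -> slen V k (F w) = 0.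
  move=> nk; rewrite slen_blocks big_seq big1 // => bl.
  rewrite mem_blocks ?increasing_enum // => /and3P[/eqP blk _ /perm_size].
  rewrite size_enum_ord => bln; rewrite word_Fx0 ?scaler0 //.
  by apply: contraLR nk => /size_flatten_ge; rewrite blk bln -leqNgt.
have [M FM] := len_below_ex (F w).
have [] := len_below_leq (leq_maxr n.+1 M) FM.
move: (maxn _ _) (leq_maxl n.+1 M) => N nN FwE _; rewrite [in RHS]FwE.
rewrite -(big_mkord xpredT (fun k => slen V k (F w))).
rewrite [in RHS](big_cat_nat (n := n.+1)) //=.
rewrite [X in _ = _ + X - _]big1_seq ?addr0; last first.
  by move=> k /andP[_]; rewrite mem_index_iota => /andP[/big_k].
rewrite [in RHS]big_ltn // [in RHS]big_ltn // slen0 slen1.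
have [_ -> _] := cF; rewrite sym_liftE.
have -> : nilp (map x (enum 'I_n)) = false.
  by rewrite /nilp size_map size_enum_ord; case: n n_gt0.
by rewrite scale0r add0r addrAC subrr add0r.
Qed.

Lemma transfer_sumE (U : lmodType K) (g : {linear V -> U})
    (Q : {linear symc V -> symc V}) : (0 < n)%N ->
  transfer_sum g (taylor Q) (taylor F) d x =
  g (sproj V (Q (F w - word [:: taylor F (map x (enum 'I_n))]))).
Proof.
move=> n_gt0; rewrite -higher_part // /transfer_sum !raddf_sum /=.
apply: eq_bigr => k _; rewrite slen_blocks !raddf_sum /=.
pose Phi bl :=
  (seq_sign K d (flatten bl) / k`!%:R) *: g (sproj V (Q (word (map Fx bl)))).
transitivity (\sum_(bl <- blocks k (enum 'I_n)) Phi bl); last first.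
  by apply: eq_bigr => bl _; rewrite !linearZ_LR.
rewrite -sum_unshuffles => [|bl bl0]; last first.
  by rewrite /Phi word_Fx0 // !raddf0 ?scaler0.
apply: eq_bigr => c /andP[_ /eqP cn]; apply: eq_bigr => pi _.
rewrite /Phi reshapeKr; last by rewrite size_map size_enum_ord cn.
rewrite koszul_signE /taylor; congr (_ *: g (sproj V (Q (word _)))).
by rewrite (map_comp x pi) -map_reshape -map_comp.
Qed.

End Transfer.

(** * The kernel of the homotopy as a subalgebra *)

Section Semifull.
Variables (K : fieldType) (A B : gcAlgebra K).
Variables (dA : gmap 1 A A) (dB : gmap 1 B B).
Variables (sigma : gmap 0 A B) (tau : gmap 0 B A) (h : gmap (-1) A A).
Hypotheses (contr : contraction dA dB sigma tau h) (sf : semifull sigma tau h).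

Lemma ker_homotopyP a : h a = 0 -> exists y b, a = tau y + h b.
Proof.
have [_ _ _ hd _] := contr; move=> ha; exists (sigma a), (- dA a).
have := hd a; rewrite ha raddf0 addr0 raddfN /= => ->.
by rewrite opprB addrC subrK.
Qed.

(** Graded commutativity gives the products in the order that the semifull
    conditions leave out. *)
Lemma tau_h_eq0 (M : lmodType K) (f : {linear A -> M}) :
    (forall a y, f (gmul (h a) (tau y)) = 0) ->
  forall a y, f (gmul (tau y) (h a)) = 0.
Proof.
move=> fht a y; elim/homog_ind: y a => [a|i y z yi IHz a].
  by rewrite raddf0 gmul0l raddf0.
rewrite raddfD gmulDDl raddfD /= IHz addr0.
elim/homog_ind: a => [|j a b aj IHb]; first by rewrite !raddf0.
rewrite !raddfD /= IHb addr0.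
by rewrite (gmulC (gmap_deg tau yi) (gmap_deg h aj)) linearZ_LR fht scaler0.
Qed.

(** Expanding (tau y + h c) (tau z + h e) gives four products, each of them
    killed by h. *)
Lemma ker_homotopy_mul a b : h a = 0 -> h b = 0 -> h (gmul a b) = 0.
Proof.
have [[hhh hht htt _] _ _ _ _] := sf.
move=> /ker_homotopyP[y [c ->]] /ker_homotopyP[z [e ->]].
by rewrite gmulDDl !raddfD /= htt hht hhh (tau_h_eq0 hht) !addr0.
Qed.

Lemma sigma_mul a b : h a = 0 -> h b = 0 ->
  sigma (gmul a b) = gmul (sigma a) (sigma b).
Proof.
have [_ shh sht stt _] := sf; have [_ _ st _ [sh _ _]] := contr.
move=> /ker_homotopyP[y [c ->]] /ker_homotopyP[z [e ->]].
rewrite gmulDDl !raddfD /= stt sht shh (tau_h_eq0 sht) !sh !st !addr0.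
by rewrite raddf0 addr0.
Qed.

End Semifull.

Theorem proposition1p27 (K : fieldType) (charK0 : [pchar K] =i pred0)
    (A B : gcAlgebra K) (dA : gmap 1 A A) (dB : gmap 1 B B)
    (dA_square : forall a, dA (dA a) = 0) (dB_square : forall x, dB (dB x) = 0)
    (dA_one : dA (gone A) = 0) (dB_one : dB (gone B) = 0)
    (sigma : gmap 0 A B) (tau : gmap 0 B A) (h : gmap (-1) A A)
    (contr : contraction dA dB sigma tau h)
    (contr_semifull : semifull sigma tau h) :
  homotopy_transfer dA dB sigma tau h
    (koszul_brackets dA) (koszul_brackets dB) (cumulant tau).
Proof.
have [sd td st hd [sh ht hh]] := contr.
have CM := ker_homotopy_mul contr contr_semifull.
have sM := sigma_mul contr contr_semifull.
have cF := cumulant_coalgebra charK0 tau.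
have brackets1 (C : gcAlgebra K) (D : gmap 1 C C) a :
    sproj C (koszul_brackets D (word [:: a])) = D a.
  rewrite koszul_bracketsE // koszulE_letter // -sconsE coder_sconsE coder1.
  by rewrite raddf0 addr0 sconsE koszulL_letter // sym_liftE.
have FR x := cumulant_brackets charK0 x td.
have hF u : h (sproj A (cumulant tau u)) = 0.
  apply: (@sproj_letters _ _ (fun a => h a = 0)); first exact: raddf0.
    by move=> a x y hx hy; rewrite linearP hx hy scaler0 addr0.
  by apply: cumulant_letters.
have sF u : sigma (sproj A (cumulant tau u)) = sproj B u.
  rewrite -sproj_symc_map; congr (sproj B _).
  exact: (symc_map_cumulant charK0 (C := fun a => h a = 0)).
split=> //; first split.
- exact: koszul_brackets_linfty.
- exact: koszul_brackets_linfty.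
- by split.
- by split=> a; rewrite /taylor ?brackets1 // cumulant_letter // sym_liftE.
move=> n d x n2 xd; have n_gt0 := ltnW n2.
have F1 := cumulant1 charK0 tau.
rewrite !(transfer_sumE charK0 cF F1 xd) //.
set w := word _; rewrite -[taylor (cumulant tau) _]/(sproj A (cumulant tau w)).
set f := sproj A _; rewrite -[taylor (koszul_brackets dB) _]
  /(sproj B (koszul_brackets dB w)).
have sf0 : sigma f = 0.
  rewrite sF sym_liftE /=; have: size [seq x i | i <- enum 'I_n] = n.
    by rewrite size_map size_enum_ord.
  by move: n2; case: [seq x i | i <- enum 'I_n]
    => [|y [|z s]] //= + n1; rewrite -n1.
(* The linear part of the brackets is dA, and Q F = F R. *)
have -> : sproj A (koszul_brackets dA (cumulant tau w - word [:: f]))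
    = sproj A (cumulant tau (koszul_brackets dB w)) - dA f.
  by rewrite FR -(brackets1 _ dA) -!linearB.
rewrite !linearB hF sF sd sf0 raddf0 subr0 sub0r; split=> //.
by have := hd f; rewrite hF raddf0 addr0 sf0 raddf0 sub0r => ->; rewrite opprK.
Qed.
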